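(* Let $R$ be a root system of type BC of rank $r$ with non-negative multiplicities $a$, $2b$, $\iota$ on the roots $\pm\varepsilon_j\pm\varepsilon_k$, $\pm\varepsilon_j$, $\pm2\varepsilon_j$, respectively. Let $\delta\ge0$ and let $\mathcal M_\delta$ be the operator $$\mathcal M_\delta=\prod_{j=1}^r\big(D_j^2+(\delta+\rho_1)^2\big),$$ where $D_1,\dots,D_r$ are the trigonometric Cherednik operators on $\mathbb R^r/2\pi Q^\vee$ and $\rho_1=\iota+b+a(r-1)$. With $|\mathrm{Cos}(t)|=\prod_{j=1}^r|\cos t_j|$ and $|\mathrm{Sin}(t)|=\prod_{j=1}^r|\sin t_j|$, the following Bernstein–Sato type formulas hold (on the open dense set of $t$ lying on no reflection hyperplane and with all $\sin t_j,\cos t_j\neq0$): $$\mathcal M_\delta|\mathrm{Cos}(t)|^\delta=\prod_{j=1}^r(\delta+a(j-1))(\delta+\iota-1+a(r-j))\,|\mathrm{Cos}(t)|^{\delta-2}$$ and $$\mathcal M_\delta|\mathrm{Sin}(t)|^\delta=\prod_{j=1}^r(\delta+a(j-1))(\delta+\iota+2b-1+a(r-j))\,|\mathrm{Sin}(t)|^{\delta-2}.$$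
   Context: Root system: $R=\{\pm\varepsilon_j\pm\varepsilon_k,\ j\ne k\}\cup\{\pm\varepsilon_j\}\cup\{\pm2\varepsilon_j\}$ with real multiplicities $a,2b,\iota\ge0$ (roots of multiplicity zero are omitted, so types B, C, D are special cases). The $\varepsilon_j$ are dual to an orthonormal basis, identified with the standard basis of $\mathbb R^r$. $Q^\vee\subset\mathbb R^r$ is the lattice generated by the vectors $\hat\alpha/(\alpha,\alpha)$, $\alpha\in R$, where $\lambda(\hat\alpha)=(\lambda,\alpha)$. $\rho_j=\iota+b+a(r-j)$. Trigonometric Cherednik operators on functions of $t=(t_1,\dots,t_r)$: $$D_j=\partial_j-ia\sum_{k<j}\frac{1-s_{kj}}{1-e^{-2i(t_k-t_j)}}+ia\sum_{j<k}\frac{1-s_{jk}}{1-e^{-2i(t_j-t_k)}}+ia\sum_{k\ne j}\frac{1-\sigma_{jk}}{1-e^{-2i(t_j+t_k)}}+2i\iota\frac{1-\sigma_j}{1-e^{-4it_j}}+2ib\frac{1-\sigma_j}{1-e^{-2it_j}}-i\rho_j,$$ where $\partial_j=\partial/\partial t_j$ and $s_{jk}$, $\sigma_{jk}$, $\sigma_j$ act on functions through the reflections in $\varepsilon_j-\varepsilon_k$ (exchange $t_j,t_k$), $\varepsilon_j+\varepsilon_k$ (replace $(t_j,t_k)$ by $(-t_k,-t_j)$), and $\varepsilon_j$ (replace $t_j$ by $-t_j$). These operators commute. *)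

(* Defs.v *)
From HB Require Import structures.
From mathcomp Require Import all_boot all_order all_fingroup all_algebra.
From mathcomp Require Import all_classical all_reals all_analysis.
From mathcomp Require Export complex.
From mathcomp Require Import ring lra.

Set Implicit Arguments.
Unset Strict Implicit.
Unset Printing Implicit Defensive.

Import Order.TTheory GRing.Theory Num.Theory.
Import numFieldNormedType.Exports.

Local Open Scope ring_scope.
Local Open Scope complex_scope.

(* Points of R^r are row vectors t : 'rV[R]_r.  Indices j : 'I_r start at 0,   *)
(* so the mathematical index 1, ..., r is j.+1.                               *)

Section RootSystem.
Variables (R : realType) (r : nat).
Implicit Types (t u v : 'rV[R]_r) (j k : 'I_r).

Definition dotv u v : R := \sum_j u 0 j * v 0 j.

Definition eps j : 'rV[R]_r := delta_mx 0 j.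

(* Type BC, with multiplicities a, 2b, iota on +-e_j+-e_k, +-e_j, +-2e_j;      *)
(* roots of multiplicity zero are omitted.                                    *)
Inductive root_BC (a b iota : R) : 'rV[R]_r -> Prop :=
| root_medium j k (s s' : bool) of a != 0 & j != k :
    root_BC a b iota ((-1) ^+ s *: eps j + (-1) ^+ s' *: eps k)
| root_short j (s : bool) of 2 * b != 0 :
    root_BC a b iota ((-1) ^+ s *: eps j)
| root_long j (s : bool) of iota != 0 :
    root_BC a b iota ((-1) ^+ s *: (2 *: eps j)).

(* Q^vee: the additive subgroup generated by the alpha / (alpha, alpha).      *)
Inductive Qvee (a b iota : R) : 'rV[R]_r -> Prop :=
| Qvee0 : Qvee a b iota 0
| Qvee_gen al of root_BC a b iota al : Qvee a b iota ((dotv al al)^-1 *: al)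
| QveeB u v of Qvee a b iota u & Qvee a b iota v : Qvee a b iota (u - v).

(* alpha(t) in pi Z is the hyperplane of alpha on the torus R^r / 2 pi Q^vee;  *)
(* it is where the denominator 1 - e^{-2 i alpha(t)} vanishes.                *)
Definition off_hyperplanes (a b iota : R) t : Prop :=
  forall al, root_BC a b iota al -> forall n : int, dotv al t != pi * n%:~R.

(* Functions on R^r / 2 pi Q^vee, as periodic functions on R^r.               *)
Record torus_fun (a b iota : R) := TorusFun {
  torus_val :> 'rV[R]_r -> R[i];
  torus_valP : forall v, Qvee a b iota v -> periodic torus_val ((2 * pi) *: v) }.

End RootSystem.

Section Operators.
Variables (R : realType) (r : nat).
Implicit Types (t u v : 'rV[R]_r) (j k : 'I_r) (f : 'rV[R]_r -> R[i]).

Definition expi (x : R) : R[i] := cos x +i* sin x.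

Definition partial j f t : R[i] :=
  'D_(eps R j) (fun u => complex.Re (f u)) t +i* 'D_(eps R j) (fun u => complex.Im (f u)) t.

Definition exchange j k t : 'rV[R]_r := xcol j k t.

Definition signed_exchange j k t : 'rV[R]_r :=
  \row_l (if l == j then - t 0 k else if l == k then - t 0 j else t 0 l).

Definition sign_change j t : 'rV[R]_r :=
  \row_l (if l == j then - t 0 j else t 0 l).

(* rho_m for the mathematical index m, 1 <= m <= r.                           *)
Definition rho (a b iota : R) (m : nat) : R := iota + b + a * (r%:R - m%:R).

(* Where the denominator of a term of nonzero multiplicity vanishes, the value *)
(* is meaningless.  This does not affect the values, even of iterates, off the *)
(* root hyperplanes: their complement is open and stable under reflections.    *)
Definition cherednik_fun (a b iota : R) j f : 'rV[R]_r -> R[i] := fun t =>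
  partial j f t
  - 'i%C * a%:C * (\sum_(k < r | (k < j)%N)
      (f t - f (exchange k j t)) / (1 - expi (- 2 * (t 0 k - t 0 j))))
  + 'i%C * a%:C * (\sum_(k < r | (j < k)%N)
      (f t - f (exchange j k t)) / (1 - expi (- 2 * (t 0 j - t 0 k))))
  + 'i%C * a%:C * (\sum_(k < r | k != j)
      (f t - f (signed_exchange j k t)) / (1 - expi (- 2 * (t 0 j + t 0 k))))
  + 2 * 'i%C * iota%:C *
      ((f t - f (sign_change j t)) / (1 - expi (- 4 * t 0 j)))
  + 2 * 'i%C * b%:C *
      ((f t - f (sign_change j t)) / (1 - expi (- 2 * t 0 j)))
  - 'i%C * (rho a b iota j.+1)%:C * f t.

Definition absCos t : R := \prod_j `|cos (t 0 j)|.
Definition absSin t : R := \prod_j `|sin (t 0 j)|.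

End Operators.

Section Periodicity.
Variables (R : realType) (r : nat) (a b iota : R).
Implicit Types (t u v : 'rV[R]_r) (j k : 'I_r) (f : 'rV[R]_r -> R[i]).

Local Notation Q := (@Qvee R r a b iota).

Lemma dotv_eps u j : dotv u (eps R j) = u 0 j.
Proof.
rewrite /dotv (bigD1 j) //= big1 ?addr0 => [|k kj].
  by rewrite mxE !eqxx mulr1.
by rewrite mxE (negPf kj) andbF mulr0.
Qed.

Lemma dotvDr u v w : dotv (u : 'rV[R]_r) (v + w) = dotv u v + dotv u w.
Proof. by rewrite -big_split; apply: eq_bigr => j _; rewrite mxE mulrDr. Qed.

Lemma dotvZr (c : R) u v : dotv u (c *: v) = c * dotv u v.
Proof. by rewrite mulr_sumr; apply: eq_bigr => j _; rewrite mxE mulrCA. Qed.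

Lemma Qvee_int v j : Q v -> exists n : int, 2 * v 0 j = n%:~R.
Proof.
elim=> [|al|u w _ [m um] _ [n wn]]; first by exists 0; rewrite mxE mulr0.
- case=> [k l s s' _ kl|k s _|k s _].
  + have -> : dotv ((-1) ^+ s *: eps R k + (-1) ^+ s' *: eps R l)
      ((-1) ^+ s *: eps R k + (-1) ^+ s' *: eps R l) = 2.
      rewrite dotvDr !dotvZr !dotv_eps !mxE !eqxx (eq_sym l k) (negPf kl) /=.
      by case: s; case: s'; rewrite ?expr0 ?expr1; ring.
    exists ((-1) ^+ s * (j == k)%:Z + (-1) ^+ s' * (j == l)%:Z).
    rewrite !mxE /= mulrA divff ?pnatr_eq0// mul1r /= rmorphD !rmorphM /=.
    by rewrite !rmorphXn /= !rmorphN1 -!pmulrn.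
  + have -> : dotv ((-1) ^+ s *: eps R k) ((-1) ^+ s *: eps R k) = 1.
      by rewrite dotvZr dotv_eps !mxE !eqxx mulr1 -expr2 sqrr_sign.
    exists (2 * ((-1) ^+ s * (j == k)%:Z)).
    by rewrite invr1 scale1r !mxE /= !rmorphM /= rmorphXn /= rmorphN1 -!pmulrn.
  + have -> : dotv ((-1) ^+ s *: (2 *: eps R k)) ((-1) ^+ s *: (2 *: eps R k)) = 4.
      rewrite !dotvZr dotv_eps !mxE !eqxx /=.
      by case: s; rewrite ?expr0 ?expr1; ring.
    exists ((-1) ^+ s * (j == k)%:Z).
    rewrite !mxE /= !rmorphM /= rmorphXn /= rmorphN1 -!pmulrn.
    by rewrite [RHS](_ : _ = 2 * 4^-1 * 2 * ((-1) ^+ s * (j == k)%:R)); [ring|field].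
- by exists (m - n); rewrite !mxE mulrBr um wn rmorphB.
Qed.

Lemma Qvee_stable (g : 'rV[R]_r -> 'rV[R]_r) :
  (forall u v, g (u - v) = g u - g v) -> (forall c u, g (c *: u) = c *: g u) ->
  (forall u, dotv (g u) (g u) = dotv u u) ->
  (forall al, root_BC a b iota al -> root_BC a b iota (g al)) ->
  forall v, Q v -> Q (g v).
Proof.
move=> gB gZ gd groot v; elim=> [|al ral|u w _ Qu _ Qw].
- by rewrite -(scale0r 0) gZ scale0r; exact: Qvee0.
- by rewrite gZ -gd; apply/Qvee_gen/groot.
- by rewrite gB; exact: QveeB.
Qed.

Lemma root_signed_perm (g : 'rV[R]_r -> 'rV[R]_r) (p : 'I_r -> 'I_r)
    (e : 'I_r -> bool) :
  injective p ->
  (forall u v, g (u + v) = g u + g v) -> (forall c u, g (c *: u) = c *: g u) ->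
  (forall k, g (eps R k) = (-1) ^+ e k *: eps R (p k)) ->
  forall al, root_BC a b iota al -> root_BC a b iota (g al).
Proof.
move=> pI gD gZ ge al [k l s s' a0 kl|k s b0|k s i0].
- by rewrite gD !gZ !ge !scalerA -!signr_addb; apply: root_medium; rewrite ?(inj_eq pI).
- by rewrite gZ ge scalerA -signr_addb; exact: root_short.
- rewrite !gZ ge (scalerA 2) (mulrC 2) -(scalerA _ 2) scalerA -signr_addb.
  exact: root_long.
Qed.

Lemma exchangeD j k u v : exchange j k (u + v) = exchange j k u + exchange j k v.
Proof. by apply/rowP => l; rewrite !mxE. Qed.
Lemma exchangeZ j k c u : exchange j k (c *: u) = c *: exchange j k u.
Proof. by apply/rowP => l; rewrite !mxE. Qed.

Lemma signed_exchangeD j k u v :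
  signed_exchange j k (u + v) = signed_exchange j k u + signed_exchange j k v.
Proof. by apply/rowP => l; rewrite !mxE; do !case: ifP => _; rewrite ?opprD. Qed.
Lemma signed_exchangeZ j k c u :
  signed_exchange j k (c *: u) = c *: signed_exchange j k u.
Proof. by apply/rowP => l; rewrite !mxE; do !case: ifP => _; rewrite ?mulrN. Qed.

Lemma sign_changeD j u v : sign_change j (u + v) = sign_change j u + sign_change j v.
Proof. by apply/rowP => l; rewrite !mxE; do !case: ifP => _; rewrite ?opprD. Qed.
Lemma sign_changeZ j c u : sign_change j (c *: u) = c *: sign_change j u.
Proof. by apply/rowP => l; rewrite !mxE; do !case: ifP => _; rewrite ?mulrN. Qed.

Lemma Qvee_signed_perm (g : 'rV[R]_r -> 'rV[R]_r) (p : {perm 'I_r})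
    (e : 'I_r -> bool) :
  (forall u l, g u 0 l = (-1) ^+ e l * u 0 (p l)) -> forall v, Q v -> Q (g v).
Proof.
move=> gE; apply: Qvee_stable.
- by move=> u v; apply/rowP => l; rewrite !(gE, mxE) mulrBr.
- by move=> c u; apply/rowP => l; rewrite !(gE, mxE) mulrCA.
- move=> u; rewrite /dotv [RHS](reindex_inj (@perm_inj _ p)).
  by apply: eq_bigr => l _; rewrite gE mulrACA -expr2 sqrr_sign mul1r.
- apply: (@root_signed_perm g (p^-1)%g (fun k => e ((p^-1)%g k))).
  + exact: perm_inj.
  + by move=> u v; apply/rowP => l; rewrite !(gE, mxE) mulrDr.
  + by move=> c u; apply/rowP => l; rewrite !(gE, mxE) mulrCA.
  + move=> k; apply/rowP => l; rewrite gE !mxE eqxx /=.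
    have -> : (p l == k) = (l == (p^-1)%g k).
      by apply/eqP/eqP => [<-|->]; rewrite ?permK ?permKV.
    by case: eqP => [->|]; rewrite ?mulr0.
Qed.

Lemma Qvee_exchange j k v : Q v -> Q (exchange j k v).
Proof.
apply: (@Qvee_signed_perm _ (tperm j k) (fun=> false)) => u l.
by rewrite expr0 mul1r !mxE.
Qed.

Lemma Qvee_signed_exchange j k v : Q v -> Q (signed_exchange j k v).
Proof.
apply: (@Qvee_signed_perm _ (tperm j k) (fun l => (l == j) || (l == k))) => u l.
rewrite !mxE; case: tpermP => [->|->|/eqP/negPf -> /eqP/negPf ->].
- by rewrite eqxx expr1 mulN1r.
- by rewrite eqxx orbT expr1 mulN1r; case: eqP => [->|].
- by rewrite expr0 mul1r.
Qed.

Lemma Qvee_sign_change j v : Q v -> Q (sign_change j v).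
Proof.
apply: (@Qvee_signed_perm _ 1%g (fun l => l == j)) => u l; rewrite !mxE perm1.
by case: eqP => [->|_]; rewrite ?expr1 ?expr0 ?mulN1r ?mul1r.
Qed.

Lemma periodicz (U V : zmodType) (f : U -> V) T :
  periodic f T -> forall (n : int) x, f (x + T *~ n) = f x.
Proof.
move=> fT [n|n] x; first exact: periodicn.
by rewrite NegzE mulrNz -pmulrn -(periodicn fT n.+1 (x - _)) subrK.
Qed.

Lemma expi_periodic (x y : R) :
  (exists n : int, y = 2 * pi * n%:~R) -> expi (x + y) = expi x.
Proof.
have E (n : int) : 2 * pi * n%:~R = (pi *+ 2 : R) *~ n.
  by rewrite -[pi *+ 2]mulr_natl mulrzr.
by case=> n ->; rewrite /expi E (periodicz (@cosD2pi R)) (periodicz (@sinD2pi R)).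
Qed.

Lemma abs_cos_periodic (n : int) (x : R) : `|cos (x + pi * n%:~R)| = `|cos x|.
Proof.
have P : periodic (fun x : R => `|cos x|) pi by move=> y; rewrite cosDpi normrN.
by rewrite mulrzr (periodicz P).
Qed.

Lemma abs_sin_periodic (n : int) (x : R) : `|sin (x + pi * n%:~R)| = `|sin x|.
Proof.
have P : periodic (fun x : R => `|sin x|) pi by move=> y; rewrite sinDpi normrN.
by rewrite mulrzr (periodicz P).
Qed.

Lemma derive_periodic (g : 'rV[R]_r -> R) p w t :
  periodic g p -> 'D_w g (t + p) = 'D_w g t.
Proof.
move=> gP; rewrite /derive gP.
suff -> : g \o shift (t + p) = g \o shift t by [].
by apply/funext => u /=; rewrite addrA gP.
Qed.

Lemma cherednik_periodic j (F : torus_fun r a b iota) v :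
  Q v -> periodic (cherednik_fun a b iota j F) ((2 * pi) *: v).
Proof.
case: F => f fP /= Qv t.
have Ef u : f (u + (2 * pi) *: v) = f u by exact: (fP v Qv u).
have Ex k l : f (exchange k l (t + (2 * pi) *: v)) = f (exchange k l t).
  by rewrite exchangeD exchangeZ (fP _ (Qvee_exchange k l Qv)).
have Es k l : f (signed_exchange k l (t + (2 * pi) *: v)) = f (signed_exchange k l t).
  by rewrite signed_exchangeD signed_exchangeZ (fP _ (Qvee_signed_exchange k l Qv)).
have Ec k : f (sign_change k (t + (2 * pi) *: v)) = f (sign_change k t).
  by rewrite sign_changeD sign_changeZ (fP _ (Qvee_sign_change k Qv)).
have Ed : partial j f (t + (2 * pi) *: v) = partial j f t.
  by rewrite /partial !derive_periodic// => u; rewrite Ef.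
have V k : exists n : int, 2 * v 0 k = n%:~R by exact: Qvee_int.
have [nj vj] := V j.
rewrite /cherednik_fun Ed Ef Ec.
congr (_ - _ * _ + _ * _ + _ * _ + _ * (_ / (1 - _)) + _ * (_ / (1 - _)) - _).
- apply: eq_bigr => k _; rewrite Ex; congr (_ / (1 - _)); rewrite !mxE.
  have [nk vk] := V k; rewrite -[RHS](@expi_periodic _ (2 * pi * (nj - nk)%:~R)).
    by congr expi; rewrite rmorphB /= -vj -vk; ring.
  by exists (nj - nk).
- apply: eq_bigr => k _; rewrite Ex; congr (_ / (1 - _)); rewrite !mxE.
  have [nk vk] := V k; rewrite -[RHS](@expi_periodic _ (2 * pi * (nk - nj)%:~R)).
    by congr expi; rewrite rmorphB /= -vj -vk; ring.
  by exists (nk - nj).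
- apply: eq_bigr => k _; rewrite Es; congr (_ / (1 - _)); rewrite !mxE.
  have [nk vk] := V k; rewrite -[RHS](@expi_periodic _ (2 * pi * (- nj - nk)%:~R)).
    by congr expi; rewrite rmorphB rmorphN /= -vj -vk; ring.
  by exists (- nj - nk).
- rewrite !mxE -[RHS](@expi_periodic _ (2 * pi * (- nj *+ 2)%:~R)).
    by congr expi; rewrite rmorphMn rmorphN /= -vj; ring.
  by exists (- nj *+ 2).
- rewrite !mxE -[RHS](@expi_periodic _ (2 * pi * (- nj)%:~R)).
    by congr expi; rewrite rmorphN /= -vj; ring.
  by exists (- nj).
Qed.

Definition cherednik j (F : torus_fun r a b iota) : torus_fun r a b iota :=
  TorusFun (@cherednik_periodic j F).

Lemma bernstein_sato_factor_periodic (delta : R) j (F : torus_fun r a b iota) v :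
  Q v -> periodic (fun t => cherednik j (cherednik j F) t
                   + ((delta + rho r a b iota 1) ^+ 2)%:C * F t) ((2 * pi) *: v).
Proof. by move=> Qv t; rewrite (torus_valP F Qv) (torus_valP _ Qv). Qed.

Definition bernstein_sato_factor (delta : R) j (F : torus_fun r a b iota) :
    torus_fun r a b iota :=
  TorusFun (@bernstein_sato_factor_periodic delta j F).

(* The product is composition, taken in the order of the indices; the D_j     *)
(* commute, so the order is immaterial.                                       *)
Definition bernstein_sato_op (delta : R) :
    torus_fun r a b iota -> torus_fun r a b iota :=
  \big[(fun G H => G \o H)/id]_(j < r) bernstein_sato_factor delta j.

Lemma absCos_pow_periodic (delta : R) v :
  Q v -> periodic (fun t => (absCos t `^ delta)%:C) ((2 * pi) *: v).
Proof.
move=> Qv t; congr ((_ `^ _)%:C); apply: eq_bigr => j _; rewrite !mxE.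
by have [n vn] := Qvee_int j Qv; rewrite mulrAC mulrC vn abs_cos_periodic.
Qed.

Lemma absSin_pow_periodic (delta : R) v :
  Q v -> periodic (fun t => (absSin t `^ delta)%:C) ((2 * pi) *: v).
Proof.
move=> Qv t; congr ((_ `^ _)%:C); apply: eq_bigr => j _; rewrite !mxE.
by have [n vn] := Qvee_int j Qv; rewrite mulrAC mulrC vn abs_sin_periodic.
Qed.

Definition absCos_pow (delta : R) : torus_fun r a b iota :=
  TorusFun (@absCos_pow_periodic delta).
Definition absSin_pow (delta : R) : torus_fun r a b iota :=
  TorusFun (@absSin_pow_periodic delta).

End Periodicity.

Arguments absCos_pow {R} r a b iota delta.
Arguments absSin_pow {R} r a b iota delta.

(* Main.v *)
Require Import Defs.
From mathcomp Require Import all_boot all_order all_fingroup all_algebra.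
From mathcomp Require Import all_classical all_reals all_analysis.
From mathcomp Require Import ring lra.
Set Implicit Arguments.
Unset Strict Implicit.
Unset Printing Implicit Defensive.
Import Order.TTheory GRing.Theory Num.Theory.
Import numFieldNormedType.Exports.
Local Open Scope ring_scope.
Local Open Scope complex_scope.

(** Let c = delta + rho_1, and let f be |Cos|^delta or |Sin|^delta, a function
    invariant under all the reflections.  The factor D_j^2 + c^2 of M_delta is
    (D_j - ic)(D_j + ic).  As the D_j commute, M_delta is also
      (D_1 - ic) ... (D_r - ic) (D_r + ic) ... (D_1 + ic),
    and in this order every factor merely multiplies what it is applied to.

    Put x_j = exp(2 i t_j) for the cosine and x_j = - exp(2 i t_j) for the sine,
    v_j = x_j / (1 + x_j) and w_j = 1 / (1 + x_j).  In both cases the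
    logarithmic derivative of f along t_j is i delta (x_j - 1) / (x_j + 1), and
    the coefficient of 1 - sigma_j in D_j is i (p / (1 - 1/x_j) + q / (1 + 1/x_j))
    with (p, q) = (iota + 2b, iota) for the cosine and (iota, iota + 2b) for the
    sine; this is why the two formulas differ by the exchange of iota and
    iota + 2b.  As (1 - y/x)^-1 (v(x) - v(y)) = v(x) w(y) and v(1/x) = w(x), the
    terms of D_m multiply the products below by affine functions of v_m.
    Collecting them gives
      (D_m + ic) (f v_1 ... v_(m-1)) = 2i (delta + a (m-1)) f v_1 ... v_m
    ([cherednik_raise]) and
      (D_m - ic) (f v_1 ... v_r w_(m+1) ... w_r)
        = -2i (delta + q - 1 + a (r-m)) f v_1 ... v_r w_m ... w_r
    ([cherednik_lower]).  The first rule is used for m = 1, ..., r and the second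
    for m = r, ..., 1; the formulas follow since 4 v_j w_j is 1 / (cos t_j)^2,
    respectively 1 / (sin t_j)^2.

    Most of the work is the commutativity of the D_j ([cherednikC]), for functions
    which are smooth off the hyperplanes.  Up to an additive constant, D_j is the
    sum of d_j and of terms proportional to c_alpha (1 - s_alpha), where
    c_alpha = 1 / (1 - exp(-2i alpha(t))) and alpha runs over the positive roots.
    The brackets of d_j with the terms of D_k cancel because d_j + d_k kills
    functions of t_j - t_k, and d_j - d_k those of t_j + t_k.  The brackets of the
    reflection terms cancel plane by plane: orthogonal roots commute, a system of
    type A2 reduces to c_alpha c_beta = c_(alpha+beta) (c_alpha + c_beta - 1)
    ([bracket_A2]), and the plane of e_j and e_k is a system of type BC2
    ([bracket_BC2]). *)

(** * Partial derivatives of complex-valued functions *)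

Section Partial.
Local Open Scope classical_set_scope.
Variables (R : realType) (r : nat).
Implicit Types (t : 'rV[R]_r) (F G : 'rV[R]_r -> R[i]) (j : 'I_r).

(** The derivative is taken on the line through t, where the calculus of one
    real variable applies. *)
Definition has_partial j F t (d : R[i]) : Prop :=
  is_derive (0 : R) (1 : R) (fun h => complex.Re (F (t + h *: eps R j))) (complex.Re d)
  /\ is_derive (0 : R) (1 : R) (fun h => complex.Im (F (t + h *: eps R j))) (complex.Im d).

Lemma derive_line (g : 'rV[R]_r -> R) t j :
  'D_(eps R j) g t = 'D_1 (fun h : R => g (t + h *: eps R j)) 0.
Proof.
rewrite /derive.
have -> : (fun h : R => h^-1 *: ((g \o shift t) (h *: eps R j) - g t)) =
  (fun h : R => h^-1 *: (((fun k : R => g (t + k *: eps R j)) \o shift 0) (h *: 1)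
                         - g (t + 0 *: eps R j))).
  by apply/funext => h /=; rewrite scale0r !addr0 [t + _]addrC [h%:A]mulr1.
by [].
Qed.

Lemma has_partialE j F t d : has_partial j F t d -> partial j F t = d.
Proof.
case=> dRe dIm; rewrite /partial !derive_line !derive_val.
by case: d {dRe dIm}.
Qed.

Lemma has_partial_eq j F t d d' : has_partial j F t d -> d = d' -> has_partial j F t d'.
Proof. by move=> ? <-. Qed.

Lemma has_partial_near j F G t d :
  (\forall u \near t, F u = G u) -> has_partial j F t d -> has_partial j G t d.
Proof.
move=> FG [dRe dIm].
have cl : (fun h : R => t + h *: eps R j) @ (0 : R) --> t.
  have -> : nbhs t = nbhs (t + 0 *: eps R j) by rewrite scale0r addr0.
  apply: (@cvgD _ 'rV[R]_r); first exact: cvg_cst.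
  exact: scalel_continuous.
have FGl : \forall h \near (0 : R), F (t + h *: eps R j) = G (t + h *: eps R j).
  exact: (cl _ FG).
by split; [apply: near_eq_is_derive dRe | apply: near_eq_is_derive dIm];
  near=> h; rewrite (near FGl h)//.
Unshelve. all: by end_near. Qed.

Lemma partial_near j F G t :
  (\forall u \near t, F u = G u) -> partial j F t = partial j G t.
Proof.
move=> FG; rewrite /partial; congr (_ +i* _); apply: near_eq_derive.
- by near=> u; rewrite (near FG u).
- by near=> u; rewrite (near FG u).
Unshelve. all: by end_near. Qed.

Lemma has_partial_indep j F t :
  (forall h : R, F (t + h *: eps R j) = F t) -> has_partial j F t 0.
Proof.
move=> Ft; split.
- rewrite [X in is_derive _ _ X _](_ : _ = cst (complex.Re (F t))); first exact: is_derive_cst.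
  by apply/funext => h /=; rewrite Ft.
- rewrite [X in is_derive _ _ X _](_ : _ = cst (complex.Im (F t))); first exact: is_derive_cst.
  by apply/funext => h /=; rewrite Ft.
Qed.

Lemma has_partialD j F G t d e : has_partial j F t d -> has_partial j G t e ->
  has_partial j (fun u => F u + G u) t (d + e).
Proof.
move=> [dF dF'] [dG dG']; split.
- rewrite raddfD /=; apply: is_derive_eq; last reflexivity.
  rewrite [X in is_derive _ _ X _](_ : _ = (fun h : R => complex.Re (F (t + h *: eps R j)))
   + (fun h : R => complex.Re (G (t + h *: eps R j)))); first exact: is_deriveD.
  by apply/funext => h /=; rewrite raddfD.
- rewrite raddfD /=; apply: is_derive_eq; last reflexivity.
  rewrite [X in is_derive _ _ X _](_ : _ = (fun h : R => complex.Im (F (t + h *: eps R j)))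
   + (fun h : R => complex.Im (G (t + h *: eps R j)))); first exact: is_deriveD.
  by apply/funext => h /=; rewrite raddfD.
Qed.

Lemma has_partialM j F G t d e : has_partial j F t d -> has_partial j G t e ->
  has_partial j (fun u => F u * G u) t (F t * e + G t * d).
Proof.
have E : t = t + 0 *: eps R j by rewrite scale0r addr0.
move=> [dF dF'] [dG dG']; split.
- rewrite [X in is_derive _ _ X _](_ : _ =
    (fun h : R => complex.Re (F (t + h *: eps R j))) *
    (fun h : R => complex.Re (G (t + h *: eps R j))) -
    (fun h : R => complex.Im (F (t + h *: eps R j))) *
    (fun h : R => complex.Im (G (t + h *: eps R j)))).
    apply: is_derive_eq; rewrite /= -E.
    by case: (F t) (G t) d e {dF dF' dG dG'} => ? ? [? ?] [? ?] [? ?] /=; rewrite /GRing.scale /=; ring.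
  by apply/funext => h; rewrite !fctE; case: (F _) (G _) => ? ? [].
- rewrite [X in is_derive _ _ X _](_ : _ =
    (fun h : R => complex.Re (F (t + h *: eps R j))) *
    (fun h : R => complex.Im (G (t + h *: eps R j))) +
    (fun h : R => complex.Im (F (t + h *: eps R j))) *
    (fun h : R => complex.Re (G (t + h *: eps R j)))).
    apply: is_derive_eq; rewrite /= -E.
    by case: (F t) (G t) d e {dF dF' dG dG'} => ? ? [? ?] [? ?] [? ?] /=; rewrite /GRing.scale /=; ring.
  by apply/funext => h; rewrite !fctE; case: (F _) (G _) => ? ? [].
Qed.

(** The real and imaginary parts of 1/F are Re F and - Im F over |F|^2. *)
Lemma has_partialV j F t d : F t != 0 -> has_partial j F t d ->
  has_partial j (fun u => (F u)^-1) t (- (F t)^-1 ^+ 2 * d).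
Proof.
have E : t = t + 0 *: eps R j by rewrite scale0r addr0.
move=> F0 [dF dF'].
pose u (h : R) := complex.Re (F (t + h *: eps R j)).
pose v (h : R) := complex.Im (F (t + h *: eps R j)).
have N0 : (u ^+ 2 + v ^+ 2) 0 != 0.
  move: F0; rewrite /u /v /= !fctE -E; apply: contraNneq.
  case: (F t) => x y /= /eqP; rewrite paddr_eq0 ?sqr_ge0// !sqrf_eq0.
  by case/andP => /eqP -> /eqP ->.
have du : is_derive (0 : R) 1 u (complex.Re d) by [].
have dv : is_derive (0 : R) 1 v (complex.Im d) by [].
have dn : is_derive (0 : R) 1 (u ^+ 2 + v ^+ 2)
    (2 * (u 0 * complex.Re d + v 0 * complex.Im d)).
  by apply: is_derive_eq; rewrite /GRing.scale /= !expr1; ring.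
have dN := is_deriveV N0 dn.
have [NE uE vE] : [/\ (u ^+ 2 + v ^+ 2) 0 = complex.Re (F t) ^+ 2 + complex.Im (F t) ^+ 2,
  u 0 = complex.Re (F t) & v 0 = complex.Im (F t)].
  by rewrite /u /v !fctE -E.
rewrite NE uE vE in N0 dN.
split.
- rewrite [X in is_derive _ _ X _](_ : _ =
    u * (fun h => ((u ^+ 2 + v ^+ 2) h)^-1)); last first.
    by apply/funext => h /=; rewrite !fctE /u /v; case: (F _).
  apply: is_derive_eq; rewrite NE uE.
  case: (F t) d N0 {dF dF' du dv dn dN NE uE vE F0} => x y [x' y'] /= N0.
  by rewrite /GRing.scale /= !expr2 /=; field; rewrite !expr2 in N0.
- rewrite [X in is_derive _ _ X _](_ : _ =
    - v * (fun h => ((u ^+ 2 + v ^+ 2) h)^-1)); last first.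
    by apply/funext => h /=; rewrite !fctE /u /v; case: (F _) => ? ? /=; rewrite ?mulNr.
  apply: is_derive_eq; rewrite NE (_ : (- v) 0 = - complex.Im (F t)); last by rewrite -vE.
  case: (F t) d N0 {dF dF' du dv dn dN NE uE vE F0} => x y [x' y'] /= N0.
  by rewrite /GRing.scale /= !expr2 /=; field; rewrite !expr2 in N0.
Qed.

Lemma has_partial_expi j (al : 'rV[R]_r) t :
  has_partial j (fun u => expi (dotv u al)) t ('i%C * (al 0 j)%:C * expi (dotv t al)).
Proof.
have E (h : R) : dotv (t + h *: eps R j) al = al 0 j * h + dotv t al.
  rewrite /dotv (eq_bigr (fun k => t 0 k * al 0 k + h * (eps R j 0 k * al 0 k))) => [|k _].
    rewrite big_split /= -mulr_sumr addrC; congr (_ + _).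
    rewrite (bigD1 j) //= big1 => [|k kj].
      by rewrite mxE !eqxx mul1r addr0 mulrC.
    by rewrite mxE (negPf kj) andbF mul0r.
  by rewrite !mxE; ring.
have dL : is_derive (0 : R) 1 (fun h : R => al 0 j * h + dotv t al) (al 0 j).
  rewrite [X in is_derive _ _ X _](_ : _ = (al 0 j \*: id) + cst (dotv t al)) //.
  by apply: is_derive_eq; rewrite addr0 [_%:A]mulr1.
split.
- rewrite [X in is_derive _ _ X _](_ : _ = @cos R \o (fun h : R => al 0 j * h + dotv t al)).
    apply: is_derive_eq; rewrite /= mulr0 add0r; ring.
  by apply/funext => h /=; rewrite E.
- rewrite [X in is_derive _ _ X _](_ : _ = @sin R \o (fun h : R => al 0 j * h + dotv t al)).
    apply: is_derive_eq; rewrite /= mulr0 add0r; ring.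
  by apply/funext => h /=; rewrite E.
Qed.

End Partial.

(** * The regular set and its reflections *)

Section Regular.
Local Open Scope classical_set_scope.
Variables (R : realType) (r : nat) (a : R).
Implicit Types (t u : 'rV[R]_r) (F G : 'rV[R]_r -> R[i]) (j k l : 'I_r).
Implicit Types (w : 'rV[R]_r -> 'rV[R]_r) (p : 'I_r -> 'I_r) (e : 'I_r -> bool).

Lemma expiD (x y : R) : expi (x + y) = expi x * expi y.
Proof. by rewrite /expi cosD sinD; apply/eqP; rewrite eq_complex /= eqxx [X in X == _]addrC eqxx. Qed.

Lemma expi0 : expi (0 : R) = 1.
Proof. by rewrite /expi cos0 sin0. Qed.

Lemma expi_neq0 (x : R) : expi x != 0.
Proof.
apply/eqP => x0; have := expiD x (- x); rewrite x0 subrr expi0 mul0r => /eqP.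
by rewrite oner_eq0.
Qed.

Lemma expiN (x : R) : expi (- x) = (expi x)^-1.
Proof. by apply: (mulfI (expi_neq0 x)); rewrite -expiD subrr expi0 divff ?expi_neq0. Qed.

Lemma expi_eq1 (x : R) : (expi x == 1) = (cos x == 1).
Proof.
rewrite /expi eq_complex /=; case: eqP => //= c1.
apply/eqP; have := cos2Dsin2 x; rewrite c1 expr1n => /eqP.
by rewrite -subr_eq0 addrAC subrr add0r sqrf_eq0 => /eqP.
Qed.

(** The second condition is imposed for a != 0 only, since the hyperplanes of
    the roots of multiplicity zero are not removed; the first one removes the
    zeros of all sin t_j and cos t_j. *)
Definition regular t : Prop :=
  (forall j, expi (4 * t 0 j) != 1) /\
  (a != 0 -> forall j k, j != k ->
     expi (2 * (t 0 j - t 0 k)) != 1 /\ expi (2 * (t 0 j + t 0 k)) != 1).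

Lemma near_expi_neq1 (g : 'rV[R]_r -> R) t : {for t, continuous g} ->
  expi (g t) != 1 -> \forall u \near t, expi (g u) != 1.
Proof.
move=> gc; rewrite expi_eq1 => c1.
have cg : {for t, continuous (fun u => cos (g u) - 1)}.
  apply: (@continuousB _ R _ (fun u => cos (g u)) (fun=> 1)); last exact: cst_continuous.
  by apply: continuous_comp => //; exact: continuous_cos.
have N0 : cos (g t) - 1 != 0 by rewrite subr_eq0.
have : \forall u \near t, cos (g u) - 1 != 0 by exact: (cvgr_neq0 _ cg N0).
apply: filterS => u /=.
by rewrite expi_eq1 subr_eq0.
Qed.

Lemma regular_near t : regular t -> \forall u \near t, regular u.
Proof.
have cc j : continuous (fun u : 'rV[R]_r => u 0 j) by exact: coord_continuous.
move=> [t4 t2]; have H4 : \forall u \near t, forall j, expi (4 * (u : 'rV[R]_r) 0 j) != 1.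
  apply: (@filter_forall _ _ (fun j (u : 'rV[R]_r) => expi (4 * u 0 j) != 1) (nbhs t)) => j; apply: near_expi_neq1 (t4 j).
  by apply: continuousM; [exact: cst_continuous|exact: cc].
have [a0|a0] := eqVneq a 0.
  by apply: filterS H4 => u uP; split => //; rewrite a0 eqxx.
have H2 : \forall u \near t, forall j k, j != k ->
    expi (2 * ((u : 'rV[R]_r) 0 j - u 0 k)) != 1 /\ expi (2 * (u 0 j + u 0 k)) != 1.
  pose P j k (u : 'rV[R]_r) := j != k ->
    expi (2 * (u 0 j - u 0 k)) != 1 /\ expi (2 * (u 0 j + u 0 k)) != 1.
  apply: (@filter_forall _ _ (fun j u => forall k, P j k u) (nbhs t)) => j.
  apply: (@filter_forall _ _ (P j) (nbhs t)) => k; rewrite /P.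
  have [->|jk] := eqVneq j k; first by apply: nearW.
  have [t2m t2p] := t2 a0 j k jk.
  have Hm : \forall u \near t, expi (2 * ((u : 'rV[R]_r) 0 j - u 0 k)) != 1.
    apply: near_expi_neq1 t2m; apply: continuousM; first exact: cst_continuous.
    by apply: continuousB; exact: cc.
  have Hp : \forall u \near t, expi (2 * ((u : 'rV[R]_r) 0 j + u 0 k)) != 1.
    apply: near_expi_neq1 t2p; apply: continuousM; first exact: cst_continuous.
    by apply: continuousD; exact: cc.
  by near=> u => _; split; near: u.
by near=> u; split; [near: u|move=> _; near: u].
Unshelve. all: by end_near. Qed.

(** A signed permutation of the coordinates which is an involution; it covers
    the three kinds of reflections at once. *)
Record reflection w p e : Prop := Reflection {
  reflectionE : forall t l, w t 0 l = (-1) ^+ e l * t 0 (p l);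
  reflection_indexK : involutive p;
  reflection_sign : forall l, e (p l) = e l }.

Lemma expi_sign (s : bool) (x : R) : (expi ((-1) ^+ s * x) == 1) = (expi x == 1).
Proof. by case: s; rewrite ?expr0 ?expr1 ?mulN1r ?mul1r// !expi_eq1 cosN. Qed.

Lemma regular_reflection w p e t : reflection w p e -> regular t -> regular (w t).
Proof.
case=> wE pK ep [t4 t2]; split => [j|a0 j k jk].
  by rewrite wE mulrCA expi_sign.
rewrite !wE.
have pjk : p j != p k by rewrite (can_eq pK).
have [m q] := t2 a0 _ _ pjk.
have N (x y : R) : x = - y -> (expi (2 * x) == 1) = (expi (2 * y) == 1).
  by move=> ->; rewrite mulrN expiN invr_eq1.
case: (e j) (e k) => - []; rewrite ?expr0 ?expr1 ?mulN1r ?mul1r ?opprK; split=> //.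
- by rewrite (N _ (t 0 (p j) - t 0 (p k))) //; ring.
- by rewrite (N _ (t 0 (p j) + t 0 (p k))) //; ring.
- by rewrite (N _ (t 0 (p j) + t 0 (p k))) //; ring.
- by rewrite (N _ (t 0 (p j) - t 0 (p k))) //; ring.
Qed.

Lemma has_partial_reflection w p e j F t d : reflection w p e ->
  has_partial (p j) F (w t) d ->
  has_partial j (fun u => F (w u)) t ((-1) ^+ e j * d).
Proof.
case=> wE pK ep.
have E (h : R) : w (t + h *: eps R j) = w t + ((-1) ^+ e j * h) *: eps R (p j).
  apply/rowP => l; rewrite wE !mxE !wE !eqxx /= mulrDr.
  have -> : (p l == j) = (l == p j) by apply/eqP/eqP => [<-|->]; rewrite pK.
  by case: eqP => [->|_]; rewrite ?mulr0// ep mulrA.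
have dL : is_derive (0 : R) 1 (fun h : R => (-1) ^+ e j * h) ((-1) ^+ e j).
  rewrite [X in is_derive _ _ X _](_ : _ = ((-1) ^+ e j : R) \*: id) //.
  by apply: is_derive_eq; rewrite [_%:A]mulr1.
have RE : (((-1) ^+ e j : R[i]) = ((-1) ^+ e j)%:C) by rewrite rmorphXn rmorphN1.
case=> dR dI; split.
- rewrite [X in is_derive _ _ X _](_ : _ =
    (fun h : R => complex.Re (F (w t + h *: eps R (p j)))) \o (fun h : R => (-1) ^+ e j * h)).
    apply: is_derive_eq; first by apply: is_derive1_comp; rewrite /= mulr0; exact: dR.
    by rewrite RE; case: (d) => x y /=; rewrite mul0r subr0 mulrC.
  by apply/funext => h; rewrite /= E.
- rewrite [X in is_derive _ _ X _](_ : _ =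
    (fun h : R => complex.Im (F (w t + h *: eps R (p j)))) \o (fun h : R => (-1) ^+ e j * h)).
    apply: is_derive_eq; first by apply: is_derive1_comp; rewrite /= mulr0; exact: dI.
    by rewrite RE; case: (d) => x y /=; rewrite mul0r addr0 mulrC.
  by apply/funext => h; rewrite /= E.
Qed.

End Regular.

(** * Smooth functions on the regular set *)

Section Smooth.
Local Open Scope classical_set_scope.
Variables (R : realType) (r : nat) (a : R).
Local Notation V := 'rV[R]_r.
Local Notation reg := (regular a).
Implicit Types (t u : V) (F G : V -> R[i]) (j k l : 'I_r).
Implicit Types (w : V -> V) (p : 'I_r -> 'I_r) (e : 'I_r -> bool).

(** A class of functions closed under partial derivatives and reflections, on
    which partial derivatives commute.  Closing under functions with a closed
    logarithmic derivative ([smooth_logder]) brings in the exponentials and the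
    powers of |Cos| and |Sin|; the symmetry of mixed derivatives then goes through
    the construction by the Leibniz rule, without estimates. *)
Inductive smooth : (V -> R[i]) -> Prop :=
| smooth_cst c : smooth (fun=> c)
| smoothD F G of smooth F & smooth G : smooth (fun t => F t + G t)
| smoothM F G of smooth F & smooth G : smooth (fun t => F t * G t)
| smoothV F of smooth F & (forall t, reg t -> F t != 0) : smooth (fun t => (F t)^-1)
| smooth_logder F (L : 'I_r -> V -> R[i]) of (forall j, smooth (L j)) &
    (forall j t, reg t -> has_partial j F t (L j t * F t)) &
    (forall j k t, reg t -> partial j (L k) t = partial k (L j) t) : smooth F
| smooth_ext F G of smooth F & (forall t, reg t -> F t = G t) : smooth G.

Lemma has_partial_cst j (c : R[i]) t : has_partial j (fun=> c) t 0.
Proof. exact: has_partial_indep. Qed.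

Lemma has_partial_ext j F G t d : (forall u, reg u -> F u = G u) -> reg t ->
  has_partial j F t d -> has_partial j G t d.
Proof.
move=> FG /regular_near tn; apply: has_partial_near.
by apply: filterS tn => u /FG.
Qed.

Lemma partial_ext j F G t : (forall u, reg u -> F u = G u) -> reg t ->
  partial j F t = partial j G t.
Proof.
by move=> FG /regular_near tn; apply: partial_near; apply: filterS tn => u /FG.
Qed.

Lemma smooth_has_partial F : smooth F ->
  forall j, exists2 G, smooth G & forall t, reg t -> has_partial j F t (G t).
Proof.
elim=> {F} [c|F G sF IF sG IG|F G sF IF sG IG|F sF IF F0|F L sL IL FL LC|F G sF IF FG] j.
- by exists (fun=> 0); [exact: smooth_cst|move=> t _; exact: has_partial_cst].
- have [F' sF' dF] := IF j; have [G' sG' dG] := IG j.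
  exists (fun t => F' t + G' t); first exact: smoothD.
  by move=> t rt; apply: has_partialD; [exact: dF|exact: dG].
- have [F' sF' dF] := IF j; have [G' sG' dG] := IG j.
  exists (fun t => F t * G' t + G t * F' t); first by apply: smoothD; apply: smoothM.
  by move=> t rt; apply: has_partialM; [exact: dF|exact: dG].
- have [F' sF' dF] := IF j.
  exists (fun t => (-1) * ((F t)^-1 * (F t)^-1) * F' t).
    have sV : smooth (fun t => (F t)^-1) by exact: smoothV.
    do 2 apply: smoothM => //; first exact: smooth_cst.
    exact: smoothM.
  move=> t rt; apply: has_partial_eq; first by apply: has_partialV; [exact: F0|exact: dF].
  by rewrite mulN1r expr2.
- by exists (fun t => L j t * F t); [apply: smoothM => //; exact: (smooth_logder sL)|exact: FL].
- have [F' sF' dF] := IF j; exists F' => // t rt.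
  exact: (has_partial_ext FG rt (dF t rt)).
Qed.

Lemma smooth_partialP j F t : smooth F -> reg t -> has_partial j F t (partial j F t).
Proof.
by case/smooth_has_partial/(_ j) => G _ dG /dG d; rewrite (has_partialE d).
Qed.

Lemma smooth_partial j F : smooth F -> smooth (partial j F).
Proof.
case/smooth_has_partial/(_ j) => G sG dG; apply: smooth_ext sG _ => t rt.
by rewrite (has_partialE (dG t rt)).
Qed.

Lemma partialD j F G t : smooth F -> smooth G -> reg t ->
  partial j (fun u => F u + G u) t = partial j F t + partial j G t.
Proof.
by move=> sF sG rt; apply: has_partialE; apply: has_partialD; exact: smooth_partialP.
Qed.

Lemma partialM j F G t : smooth F -> smooth G -> reg t ->
  partial j (fun u => F u * G u) t = F t * partial j G t + G t * partial j F t.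
Proof.
by move=> sF sG rt; apply: has_partialE; apply: has_partialM; exact: smooth_partialP.
Qed.

Lemma partial_cst j (c : R[i]) t : partial j (fun=> c) t = 0.
Proof. exact/has_partialE/has_partial_cst. Qed.

Lemma partialV j F t : smooth F -> F t != 0 -> reg t ->
  partial j (fun u => (F u)^-1) t = - (F t)^-1 ^+ 2 * partial j F t.
Proof.
by move=> sF F0 rt; apply: has_partialE; apply: has_partialV => //; exact: smooth_partialP.
Qed.

(* Unification must not look for coincidences inside the limits. *)
Local Opaque partial.

Lemma partialC F j k t : smooth F -> reg t ->
  partial j (partial k F) t = partial k (partial j F) t.
Proof.
move=> sF; elim: sF j k t => {F} [c|F G sF IF sG IG|F G sF IF sG IG|F sF IF F0|F L sL IL FL LC|F G sF IF FG] j k t rt.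
- have E l : forall u, reg u -> partial l (fun=> c) u = (fun=> 0) u.
    by move=> u _; rewrite partial_cst.
  by rewrite (partial_ext j (E k) rt) (partial_ext k (E j) rt) !partial_cst.
- have E l : forall u, reg u -> partial l (fun t => F t + G t) u = partial l F u + partial l G u.
    by move=> u ru; exact: partialD.
  have s l := smooth_partial l sF; have s' l := smooth_partial l sG.
  apply: (etrans (partial_ext j (E k) rt)); apply: (etrans _ (esym (partial_ext k (E j) rt))).
  apply: (etrans (partialD j (s k) (s' k) rt)); apply: (etrans _ (esym (partialD k (s j) (s' j) rt))).
  exact: (congr2 _ (IF j k _ rt) (IG j k _ rt)).
- have E l : forall u, reg u -> partial l (fun t => F t * G t) u =
      F u * partial l G u + G u * partial l F u.
    by move=> u ru; exact: partialM.
  have s l := smooth_partial l sF; have s' l := smooth_partial l sG.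
  apply: (etrans (partial_ext j (E k) rt)); apply: (etrans _ (esym (partial_ext k (E j) rt))).
  have X l m := partialD l (smoothM sF (s' m)) (smoothM sG (s m)) rt.
  rewrite (X j k) (X k j).
  rewrite (partialM j sF (s' k) rt) (partialM k sF (s' j) rt).
  rewrite (partialM j sG (s k) rt) (partialM k sG (s j) rt) (IF j k _ rt) (IG j k _ rt).
  move: (partial k (partial j F) t) (partial k (partial j G) t) => FF GG.
  move: (partial k F t) (partial k G t) (partial j F t) (partial j G t) (F t) (G t) => *.
  by ring.
- have E l : forall u, reg u -> partial l (fun t => (F t)^-1) u =
      (-1) * ((F u)^-1 * (F u)^-1) * partial l F u.
    by move=> u ru; rewrite (partialV l sF (F0 _ ru) ru) mulN1r expr2.
  have s l := smooth_partial l sF; have sV := smoothV sF F0.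
  have sVV := smoothM sV sV; have s1 := smoothM (smooth_cst (-1)) sVV.
  apply: (etrans (partial_ext j (E k) rt)); apply: (etrans _ (esym (partial_ext k (E j) rt))).
  rewrite (partialM j s1 (s k) rt) (partialM k s1 (s j) rt) (IF j k _ rt).
  have X l := partialM l (smooth_cst (-1)) sVV rt; rewrite (X j) (X k).
  rewrite (partialM j sV sV rt) (partialM k sV sV rt) !partial_cst.
  move: (partial k (partial j F) t) => FF.
  rewrite (partialV j sF (F0 _ rt) rt) (partialV k sF (F0 _ rt) rt).
  move: (partial k F t) (partial j F t) (F t)^-1 => *.
  by ring.
- have E l : forall u, reg u -> partial l F u = L l u * F u.
    by move=> u ru; exact/has_partialE/FL.
  have sF := smooth_logder sL FL LC.
  apply: (etrans (partial_ext j (E k) rt)); apply: (etrans _ (esym (partial_ext k (E j) rt))).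
  rewrite (partialM j (sL k) sF rt) (partialM k (sL j) sF rt) (E j _ rt) (E k _ rt).
  rewrite (LC j k _ rt).
  by move: (partial k (L j) t) (L k t) (L j t) (F t) => *; ring.
- have E l : forall u, reg u -> partial l G u = partial l F u.
    by move=> u ru; apply: partial_ext => // v rv; rewrite FG.
  by rewrite (partial_ext j (E k) rt) (partial_ext k (E j) rt) IF.
Qed.

Lemma partial_reflection w p e j F t : smooth F -> reflection w p e -> reg t ->
  partial j (fun u => F (w u)) t = (-1) ^+ e j * partial (p j) F (w t).
Proof.
move=> sF wr rt; apply/has_partialE/(has_partial_reflection wr)/smooth_partialP => //.
exact: regular_reflection wr rt.
Qed.

Lemma smooth_reflection w p e F : reflection w p e -> smooth F -> smooth (fun t => F (w t)).
Proof.
move=> wr; have rw t : reg t -> reg (w t) by exact: regular_reflection wr.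
elim=> {F} [c|F G sF IF sG IG|F G sF IF sG IG|F sF IF F0|F L sL IL FL LC|F G sF IF FG].
- exact: smooth_cst.
- exact: smoothD.
- exact: smoothM.
- by apply: smoothV => // t rt; apply/F0/rw.
- apply: (@smooth_logder _ (fun j t => (-1) ^+ e j * L (p j) (w t))).
  + by move=> j; apply: smoothM => //; exact: smooth_cst.
  + move=> j t rt; apply: has_partial_eq.
      by apply: (has_partial_reflection wr); apply: FL; exact: rw.
    by rewrite mulrA.
  + move=> j k t rt.
    have sc (c : R[i]) := smooth_cst c.
    have sw l : smooth (fun t => L (p l) (w t)) by exact: IL.
    rewrite (partialM j (sc _) (sw k) rt) (partialM k (sc _) (sw j) rt) !partial_cst.
    rewrite (partial_reflection j (sL _) wr rt) (partial_reflection k (sL _) wr rt).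
    rewrite (LC (p j) (p k) _ (rw _ rt)).
    by move: (partial _ (L (p j)) _) (L (p j) _) (L (p k) _) => *; ring.
- by apply: smooth_ext IF _ => t rt; apply/FG/rw.
Qed.

Lemma smooth_sum (I : Type) (s : seq I) (P : pred I) (F : I -> V -> R[i]) :
  (forall i, smooth (F i)) -> smooth (fun t => \sum_(i <- s | P i) F i t).
Proof.
move=> sF; elim: s => [|i s IH].
  by apply: smooth_ext (smooth_cst 0) _ => t _; rewrite big_nil.
case Pi: (P i).
- by apply: smooth_ext (smoothD (sF i) IH) _ => t _; rewrite big_cons Pi.
- by apply: smooth_ext IH _ => t _; rewrite big_cons Pi.
Qed.

Lemma partial_sum (I : Type) (s : seq I) (P : pred I) (F : I -> V -> R[i]) j t :
  (forall i, smooth (F i)) -> reg t ->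
  partial j (fun t => \sum_(i <- s | P i) F i t) t = \sum_(i <- s | P i) partial j (F i) t.
Proof.
move=> sF rt; elim: s => [|i s IH].
  rewrite big_nil -[RHS](partial_cst j 0 t); apply: partial_ext rt => u _.
  by rewrite big_nil.
rewrite big_cons -IH; case Pi: (P i).
- rewrite -(partialD j (sF i) (smooth_sum s P sF) rt).
  by apply: partial_ext rt => u _; rewrite big_cons Pi.
- by apply: partial_ext rt => u _; rewrite big_cons Pi.
Qed.

Lemma smooth_expi (al : V) : smooth (fun t => expi (dotv t al)).
Proof.
apply: (@smooth_logder _ (fun j _ => 'i%C * (al 0 j)%:C)).
- by move=> j; exact: smooth_cst.
- by move=> j t _; exact: has_partial_expi.
- by move=> j k t _; rewrite !partial_cst.
Qed.

Lemma partial_expi (al : V) j t :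
  partial j (fun u => expi (dotv u al)) t = 'i%C * (al 0 j)%:C * expi (dotv t al).
Proof. exact/has_partialE/has_partial_expi. Qed.

End Smooth.

(** * Brackets of difference operators in rank two *)

Section RankTwo.
Variables (K : fieldType) (T : Type).
Implicit Types (c : T -> K) (s : T -> T) (F G : T -> K) (P Q : (T -> K) -> T -> K).

Definition difference c s F (t : T) : K := c t * (F t - F (s t)).

Definition bracket P Q F (t : T) : K := P (Q F) t - Q (P F) t.

Lemma differenceN c s F t :
  difference (fun x => - c x) s F t = - difference c s F t.
Proof. by rewrite /difference mulNr. Qed.

Lemma differenceD c s F G t :
  difference c s (fun x => F x + G x) t = difference c s F t + difference c s G t.
Proof. by rewrite /difference; ring. Qed.

Lemma difference_opp c s F t :
  difference c s (fun x => - F x) t = - difference c s F t.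
Proof. by rewrite /difference; ring. Qed.

Lemma differenceZ c s (x : K) F t :
  difference c s (fun u => x * F u) t = x * difference c s F t.
Proof. by rewrite /difference; ring. Qed.

Lemma difference_sum c s (I : Type) (h : seq I) (P : pred I)
    (F : I -> T -> K) t :
  difference c s (fun x => \sum_(i <- h | P i) F i x) t =
  \sum_(i <- h | P i) difference c s (F i) t.
Proof. by rewrite /difference -sumrB mulr_sumr. Qed.

Lemma bracket_orthogonal c s c' s' F t :
  c (s' t) = c t -> c' (s t) = c' t -> s (s' t) = s' (s t) ->
  bracket (difference c s) (difference c' s') F t = 0.
Proof. by rewrite /bracket /difference => -> -> ->; ring. Qed.

(** Here alpha, beta and gamma = alpha + beta are the roots of a system of type
    A2, and u, v, w are c_alpha, c_beta, c_gamma at t; the reflections permute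
    them, with c_(-alpha) = 1 - c_alpha.  The coefficients are shifted by m, n, o
    in {0, 1} according to the signs of the roots, which amounts to replacing
    c_alpha by - c_(-alpha) for a negative root; gamma has the sign of alpha and
    beta when these agree.  After expansion only the values of F at the images of
    t under the two rotations survive, with opposite coefficients. *)
Lemma bracket_A2 (ca cb cg : T -> K) (sa sb sg : T -> T) F t
    (kappa u v w : K) (m n o : bool) :
  sg (sb t) = sa (sg t) -> sb (sa t) = sa (sg t) ->
  sb (sg t) = sa (sb t) -> sg (sa t) = sa (sb t) ->
  ca t = kappa * (u - m%:R) -> cb t = kappa * (v - n%:R) -> cg t = kappa * (w - o%:R) ->
  ca (sb t) = kappa * (w - m%:R) -> ca (sg t) = kappa * (1 - v - m%:R) ->
  cb (sa t) = kappa * (w - n%:R) -> cb (sg t) = kappa * (1 - u - n%:R) ->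
  cg (sa t) = kappa * (v - o%:R) -> cg (sb t) = kappa * (u - o%:R) ->
  (m == n -> o = m) ->
  kappa * (u * v - w * (u + v - 1)) = 0 ->
  bracket (difference cg sg) (difference cb sb) F t
  + bracket (difference ca sa) (difference cb sb) F t
  - bracket (difference cg sg) (difference ca sa) F t = 0.
Proof.
move=> E1 E2 E3 E4 a1 b1 g1 a2 a3 b2 b3 g2 g3 mno rel.
rewrite /bracket /difference E1 E2 E3 E4 a1 b1 g1 a2 a3 b2 b3 g2 g3.
set D := kappa * _ in rel.
transitivity (kappa * D * (F (sa (sb t)) - F (sa (sg t)))); last by rewrite rel mulr0 mul0r.
rewrite /D.
case: m n o mno {a1 b1 g1 a2 a3 b2 b3 g2 g3} => - [] [] // H; try by have := H isT.
all: by rewrite /= ?mulr0n ?mulr1n; ring.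
Qed.

(** The same for the plane of e_1 and e_2: p, b, q1, q2 are the coefficients of
    e_1 - e_2, e_1 + e_2, e_1, e_2, and s, S, s1, s2 the reflections.  Again only
    the values of F at the images of t under the two rotations of order four
    survive; the nine equalities on top list the products of two reflections. *)
Lemma bracket_BC2 (p b q1 q2 : T -> K) (s S s1 s2 : T -> T) F t
    (kappa u v n m : K) :
  s (S t) = s1 (s2 t) -> S (s t) = s1 (s2 t) -> s2 (s1 t) = s1 (s2 t) ->
  s2 (s t) = s (s1 t) -> S (s2 t) = s (s1 t) -> s1 (S t) = s (s1 t) ->
  s1 (s t) = s (s2 t) -> S (s1 t) = s (s2 t) -> s2 (S t) = s (s2 t) ->
  p t = kappa * (u - n) -> p (S t) = p t ->
  p (s1 t) = kappa * (1 - v - n) -> p (s2 t) = kappa * (v - n) ->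
  b t = kappa * v -> b (s t) = b t ->
  b (s1 t) = kappa * (1 - u) -> b (s2 t) = kappa * u ->
  q1 (s t) = q2 t -> q2 (s t) = q1 t -> q1 (S t) = m - q2 t -> q2 (S t) = m - q1 t ->
  q1 (s2 t) = q1 t -> q2 (s1 t) = q2 t ->
  kappa * (q1 t * (u + v - 1) + q2 t * (v - u) - m * v) = 0 ->
  bracket (fun G x => difference p s G x + difference b S G x + difference q1 s1 G x)
    (fun G x => - difference p s G x + difference b S G x + difference q2 s2 G x) F t = 0.
Proof.
move=> E1 E2 E3 E4 E5 E6 E7 E8 E9 p1 p2 p3 p4 b1 b2 b3 b4 q11 q21 q12 q22 q13 q23 rel.
set D := kappa * _ in rel.
transitivity (D * (F (s (s1 t)) - F (s (s2 t)))); last by rewrite rel mul0r.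
rewrite /bracket /difference.
rewrite E1 E2 E3 E4 E5 E6 E7 E8 E9 p2 b2 q11 q21 q12 q22 q13 q23 p1 p3 p4 b1 b3 b4 /D.
ring.
Qed.

(** The relation needed by [bracket_BC2], with z, w = exp(2 i t_1), exp(2 i t_2). *)
Lemma BC2_relation (p s z w : K) : z != 0 -> w != 0 -> z != 1 -> w != 1 ->
  z ^+ 2 != 1 -> w ^+ 2 != 1 -> z != w -> z * w != 1 ->
  (p * (1 - (z ^+ 2)^-1)^-1 + s * (1 - z^-1)^-1)
    * ((1 - (z * w^-1)^-1)^-1 + (1 - (z * w)^-1)^-1 - 1)
  + (p * (1 - (w ^+ 2)^-1)^-1 + s * (1 - w^-1)^-1)
    * ((1 - (z * w)^-1)^-1 - (1 - (z * w^-1)^-1)^-1)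
  - (p + s) * (1 - (z * w)^-1)^-1 = 0.
Proof.
move=> z0 w0 z1 w1 z2 w2 zw zw1; field.
by rewrite z0 w0 /= !subr_eq0 z1 w1 z2 w2 zw zw1.
Qed.

End RankTwo.

(** * Cherednik operators as sums over roots *)

Section Cherednik.
Local Open Scope classical_set_scope.
Variables (R : realType) (r : nat) (a b iota : R).
Local Notation V := 'rV[R]_r.
Local Notation reg := (regular a).
Implicit Types (t u : V) (F G : V -> R[i]) (j k l m : 'I_r).

Lemma exchangeE j k t l :
  exchange j k t 0 l = if l == j then t 0 k else if l == k then t 0 j else t 0 l.
Proof.
by rewrite mxE; case: tpermP => [->|->|/eqP/negPf -> /eqP/negPf ->]; rewrite ?eqxx //; case: eqP => [->|].
Qed.

Lemma signed_exchangeE j k t l :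
  signed_exchange j k t 0 l = if l == j then - t 0 k else if l == k then - t 0 j else t 0 l.
Proof. by rewrite mxE. Qed.

Lemma sign_changeE j t l : sign_change j t 0 l = if l == j then - t 0 j else t 0 l.
Proof. by rewrite mxE. Qed.

Definition coordE := (exchangeE, signed_exchangeE, sign_changeE).

Lemma exchange_reflection j k : reflection (@exchange R r j k) (tperm j k) (fun=> false).
Proof. by split => [t l||//]; [rewrite expr0 mul1r mxE|exact: tpermK]. Qed.

Lemma signed_exchange_reflection j k :
  reflection (@signed_exchange R r j k) (tperm j k) (fun l => (l == j) || (l == k)).
Proof.
split => [t l||l]; last 2 first.
- exact: tpermK.
- by case: tpermP => [->|->|]; rewrite ?eqxx ?orbT.
rewrite mxE; case: tpermP => [->|->|/eqP/negPf -> /eqP/negPf ->].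
- by rewrite eqxx expr1 mulN1r.
- by rewrite eqxx orbT expr1 mulN1r; case: eqP => [->|].
- by rewrite expr0 mul1r.
Qed.

Lemma sign_change_reflection j : reflection (@sign_change R r j) id (fun l => l == j).
Proof.
split=> // t l; rewrite mxE; case: eqP => [->|_]; first by rewrite expr1 mulN1r.
by rewrite expr0 mul1r.
Qed.

Lemma exchangeC j k : @exchange R r j k = exchange k j.
Proof. by apply/funext => t; apply/rowP => l; rewrite !mxE tpermC. Qed.

Lemma signed_exchangeC j k : @signed_exchange R r j k = signed_exchange k j.
Proof.
apply/funext => t; apply/rowP => l; rewrite !coordE.
by case: (eqVneq l j) => [lj|_]; case: (eqVneq l k) => [lk|_] //; rewrite -lj -lk.
Qed.

Definition cfactor (x : R) : R[i] := (1 - expi (- 2 * x))^-1.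

Definition kappa : R[i] := 'i%C * a%:C.

(** The shift by 1 for k < j writes the coefficient - 1 / (1 - exp(-2i(t_k - t_j)))
    of D_j as 1 / (1 - exp(-2i(t_j - t_k))) - 1, so that all k != j are treated
    alike. *)
Definition coef_minus j k t : R[i] := kappa * (cfactor (t 0 j - t 0 k) - (k < j)%N%:R).
Definition coef_plus j k t : R[i] := kappa * cfactor (t 0 j + t 0 k).
Definition coef_axis j t : R[i] :=
  2 * 'i%C * iota%:C * cfactor (2 * t 0 j) + 2 * 'i%C * b%:C * cfactor (t 0 j).

Definition minus_op j k := difference (coef_minus j k) (exchange j k).
Definition plus_op j k := difference (coef_plus j k) (signed_exchange j k).
Definition axis_op j := difference (coef_axis j) (sign_change j).
Definition pair_op j k F t := minus_op j k F t + plus_op j k F t.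
Definition reflection_op j F t := \sum_(k < r | k != j) pair_op j k F t + axis_op j F t.

Lemma cfactorN x : expi (2 * x) != 1 -> cfactor (- x) = 1 - cfactor x.
Proof.
move=> x1; rewrite /cfactor mulrNN mulNr expiN.
have e0 := expi_neq0 (2 * x); move: (expi (2 * x)) x1 e0 => z z1 z0.
by field; rewrite z0 /= !subr_eq0 z1 [_ == z]eq_sym z1.
Qed.

Lemma cfactor_mul x y : expi (2 * x) != 1 -> expi (2 * y) != 1 -> expi (2 * (x + y)) != 1 ->
  cfactor x * cfactor y = cfactor (x + y) * (cfactor x + cfactor y - 1).
Proof.
rewrite /cfactor !mulNr !expiN mulrDr expiD.
have x0 := expi_neq0 (2 * x); have y0 := expi_neq0 (2 * y).
move: (expi (2 * x)) (expi (2 * y)) x0 y0 => z w z0 w0 z1 w1 zw1.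
by field; rewrite z0 w0 /= !subr_eq0 z1 w1 zw1.
Qed.

Lemma regular_diff j k t : reg t -> a != 0 -> j != k -> expi (2 * (t 0 j - t 0 k)) != 1.
Proof. by case=> _ t2 a0 jk; case: (t2 a0 j k jk). Qed.

Lemma regular_sum j k t : reg t -> a != 0 -> j != k -> expi (2 * (t 0 j + t 0 k)) != 1.
Proof. by case=> _ t2 a0 jk; case: (t2 a0 j k jk). Qed.

Lemma regular_double j t : reg t -> expi (2 * t 0 j) ^+ 2 != 1.
Proof.
case=> t4 _; have := t4 j; rewrite (_ : 4 * t 0 j = 2 * t 0 j + 2 * t 0 j); last by ring.
by rewrite expiD -expr2.
Qed.

Lemma regular_quadruple j t : reg t -> expi (2 * (2 * t 0 j)) != 1.
Proof. by case=> + _ => /(_ j); rewrite mulrA -natrM. Qed.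

Lemma regular_single j t : reg t -> expi (2 * t 0 j) != 1.
Proof. by move/(regular_double j); apply: contraNneq => ->; rewrite expr1n. Qed.

Lemma sum_split_lt (G : 'I_r -> R[i]) j :
  \sum_(k < r | k != j) G k = \sum_(k < r | (k < j)%N) G k + \sum_(k < r | (j < k)%N) G k.
Proof.
rewrite (bigID (fun k : 'I_r => (k < j)%N)) /=; congr (_ + _); apply: eq_bigl => k.
- by case: ltnP => //; rewrite ?andbF// andbT => kj; apply/eqP => E; rewrite E ltnn in kj.
- by rewrite -leqNgt ltn_neqAle eq_sym.
Qed.

(** The terms of D_j and D_k in the root e_j - e_k are opposite, as are its
    coordinates on e_j and e_k. *)
Lemma minus_op_anti j k F t : reg t -> j != k -> minus_op k j F t = - minus_op j k F t.
Proof.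
move=> rt jk; rewrite /minus_op /difference exchangeC -mulNr; congr (_ * _).
rewrite /coef_minus /kappa; have [->|a0] := eqVneq a 0; first by rewrite mulr0 !mul0r oppr0.
rewrite -(opprB (t 0 j)) cfactorN ?regular_diff// -mulrN; congr (_ * _).
have : ((j < k) + (k < j) = 1)%N by move: jk; rewrite -[j == k]/(j == k :> nat); case: ltngtP.
by case: (j < k)%N (k < j)%N => - [] //= _; rewrite ?mulr1n ?mulr0n; ring.
Qed.

Lemma plus_opC j k : plus_op k j = plus_op j k.
Proof.
rewrite /plus_op [signed_exchange k j]signed_exchangeC.
rewrite (_ : coef_plus k j = coef_plus j k) //.
by apply/funext => u; rewrite /coef_plus [u 0 k + _]addrC.
Qed.

Lemma minus_opD j k F G t :
  minus_op j k (fun u => F u + G u) t = minus_op j k F t + minus_op j k G t.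
Proof. exact: differenceD. Qed.

Lemma plus_opD j k F G t :
  plus_op j k (fun u => F u + G u) t = plus_op j k F t + plus_op j k G t.
Proof. exact: differenceD. Qed.

Lemma cherednikE j F t : reg t -> cherednik_fun a b iota j F t =
  partial j F t + reflection_op j F t - 'i%C * (rho r a b iota j.+1)%:C * F t.
Proof.
move=> rt; rewrite /cherednik_fun; congr (_ - _).
rewrite -!addrA; congr (_ + _); rewrite /reflection_op /pair_op big_split /= (sum_split_lt (fun k => minus_op j k F t)) -!addrA.
congr (_ + (_ + (_ + _))).
- rewrite mulr_sumr -sumrN; apply: eq_bigr => k kj.
  have jk : k != j by apply: contraTneq kj => ->; rewrite ltnn.
  rewrite (minus_op_anti _ rt jk) /minus_op /difference /coef_minus /cfactor.
  by rewrite ltnNge (ltnW kj) /= mulr0n subr0 -!mulrA [X in _ * (_ * X)]mulrC.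
- rewrite mulr_sumr; apply: eq_bigr => k jk.
  rewrite /minus_op /difference /coef_minus /cfactor.
  by rewrite ltnNge (ltnW jk) /= mulr0n subr0 -!mulrA [X in _ * (_ * X)]mulrC.
- rewrite mulr_sumr; apply: eq_bigr => k jk.
  by rewrite /plus_op /difference /coef_plus /cfactor -!mulrA [X in _ * (_ * X)]mulrC.
- rewrite /axis_op /difference /coef_axis /cfactor [RHS]mulrDl; congr (_ + _).
    rewrite (_ : - 2 * (2 * t 0 j) = - 4 * t 0 j); last by ring.
    by rewrite -!mulrA [(_ - _) / _]mulrC.
  by rewrite -!mulrA [(_ - _) / _]mulrC.
Qed.

End Cherednik.

(** * Three indices: systems of type A2 *)

Section Reflections.
Variables (R : realType) (r : nat) (a b iota : R).
Local Notation V := 'rV[R]_r.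
Local Notation reg := (regular a).
Local Notation alpha := (coef_minus a).
Local Notation beta := (coef_plus a).
Local Notation q := (coef_axis b iota).
Local Notation A := (minus_op a).
Local Notation B := (plus_op a).
Local Notation X := (pair_op a).
Local Notation Q := (axis_op b iota).
Local Notation N := (reflection_op a b iota).
Implicit Types (t u : V) (F G : V -> R[i]) (j k l m : 'I_r).

Lemma difference_ext c s p e F G t : reflection s p e ->
  (forall u, reg u -> F u = G u) -> reg t ->
  difference c s F t = difference c s G t.
Proof.
by move=> sr FG rt; rewrite /difference !FG //; exact: regular_reflection sr rt.
Qed.

(** The roots +-e_j +- e_k, +-e_j +- e_l, +-e_k +- e_l form a system of type D3,
    whose planes of type A2 are four: at most one sign change turns any of them
    into the plane of e_j - e_k, e_k - e_l and e_j - e_l. *)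
Section Braid.
Variables (j k l : 'I_r).
Hypotheses (jk : j != k) (jl : j != l) (kl : k != l).
Let kj : k != j. Proof. by rewrite eq_sym. Qed.
Let lj : l != j. Proof. by rewrite eq_sym. Qed.
Let lk : l != k. Proof. by rewrite eq_sym. Qed.
Let neqs := (negPf jk, negPf jl, negPf kl, negPf kj, negPf lj, negPf lk).

Ltac points :=
  let m := fresh "m" in let E := fresh "E" in
  apply/rowP => m; rewrite ?(coordE, neqs, eqxx);
  case: (eqVneq m j) => E; rewrite ?E ?(neqs, eqxx); [|
  case: (eqVneq m k) => {}E; rewrite ?E ?(neqs, eqxx); [|
  case: (eqVneq m l) => {}E; rewrite ?E ?(neqs, eqxx)]]; rewrite /= ?opprK //.

Ltac coords := rewrite /coef_minus /coef_plus ?(coordE, neqs, eqxx) ?opprK //.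

(** Positivity of e_j - e_l is forced when e_j - e_k and e_k - e_l have the same
    sign. *)
Lemma index_order : (k < j)%N == (l < k)%N -> (l < j)%N = (k < j)%N.
Proof.
have [kj'|] := ltnP k j; have [lk'|] := ltnP l k; rewrite ?eqxx //.
- by move=> _; apply: ltn_trans lk' kj'.
- by move=> kl' jk' _; apply/negbTE; rewrite -leqNgt; apply: leq_trans jk' kl'.
Qed.

Lemma A2_minus_minus F t : reg t ->
  bracket (A j l) (A k l) F t + bracket (A j k) (A k l) F t
  - bracket (A j l) (A j k) F t = 0.
Proof.
move=> rt; have [a0|a0] := eqVneq a 0.
  by rewrite /bracket /minus_op /difference /coef_minus /kappa a0 !(mulr0, mul0r, subrr, addr0).
have cN x : expi (2 * x) != 1 -> cfactor (- x) = 1 - cfactor x := @cfactorN R x.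
have rD x y : x != y -> expi (2 * (t 0 x - t 0 y)) != 1 by apply: (regular_diff rt a0).
apply: (@bracket_A2 _ _ _ _ _ _ _ _ F t (kappa a) (cfactor (t 0 j - t 0 k))
  (cfactor (t 0 k - t 0 l)) (cfactor (t 0 j - t 0 l)) (k < j)%N (l < k)%N (l < j)%N).
1-4: by points.
all: try by coords.
- by coords; rewrite -(opprB (t 0 k)) cN // rD.
- by coords; rewrite -(opprB (t 0 j)) cN // rD.
- exact: index_order.
- rewrite cfactor_mul ?rD //.
    by rewrite addrA subrK subrr mulr0.
  by rewrite addrA subrK rD.
Qed.

Lemma A2_minus_plus F t : reg t ->
  bracket (B j l) (B k l) F t + bracket (A j k) (B k l) F t
  - bracket (B j l) (A j k) F t = 0.
Proof.
move=> rt; have [a0|a0] := eqVneq a 0.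
  by rewrite /bracket /minus_op /plus_op /difference /coef_minus /coef_plus /kappa a0 !(mulr0, mul0r, subrr, addr0).
have cN x : expi (2 * x) != 1 -> cfactor (- x) = 1 - cfactor x := @cfactorN R x.
have rD x y : x != y -> expi (2 * (t 0 x - t 0 y)) != 1 by apply: (regular_diff rt a0).
have rS x y : x != y -> expi (2 * (t 0 x + t 0 y)) != 1 by apply: (regular_sum rt a0).
apply: (@bracket_A2 _ _ _ _ _ _ _ _ F t (kappa a) (cfactor (t 0 j - t 0 k))
  (cfactor (t 0 k + t 0 l)) (cfactor (t 0 j + t 0 l)) (k < j)%N false false).
1-4: by points.
all: try by coords; rewrite ?subr0.
- by coords; rewrite -opprD [t 0 l + _]addrC cN ?subr0 // rS.
- by coords; rewrite -(opprB (t 0 j)) cN ?subr0 // rD.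
- by case: (k < j)%N.
- have E : t 0 j - t 0 k + (t 0 k + t 0 l) = t 0 j + t 0 l by rewrite addrA subrK.
  rewrite cfactor_mul ?E ?rD ?rS //.
  by rewrite subrr mulr0.
Qed.

Lemma A2_plus_minus F t : reg t ->
  bracket (B j l) (A l k) F t + bracket (B j k) (A l k) F t
  - bracket (B j l) (B j k) F t = 0.
Proof.
move=> rt; have [a0|a0] := eqVneq a 0.
  by rewrite /bracket /minus_op /plus_op /difference /coef_minus /coef_plus /kappa a0 !(mulr0, mul0r, subrr, addr0).
have cN x : expi (2 * x) != 1 -> cfactor (- x) = 1 - cfactor x := @cfactorN R x.
have rD x y : x != y -> expi (2 * (t 0 x - t 0 y)) != 1 by apply: (regular_diff rt a0).
have rS x y : x != y -> expi (2 * (t 0 x + t 0 y)) != 1 by apply: (regular_sum rt a0).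
apply: (@bracket_A2 _ _ _ _ _ _ _ _ F t (kappa a) (cfactor (t 0 j + t 0 k))
  (cfactor (t 0 l - t 0 k)) (cfactor (t 0 j + t 0 l)) false (k < l)%N false).
1-4: by points.
all: try by coords; rewrite ?subr0.
- by coords; rewrite [_ + t 0 k]addrC -(opprB (t 0 l)) cN ?subr0 // rD.
- by coords; rewrite [t 0 l + _]addrC.
- by coords; rewrite -opprD cN // rS.
- by coords; rewrite [_ + t 0 l]addrC subr0.
- have E : t 0 j + t 0 k + (t 0 l - t 0 k) = t 0 j + t 0 l by ring.
  rewrite cfactor_mul ?E ?rD ?rS //.
  by rewrite subrr mulr0.
Qed.

(** The roots are e_j + e_k, - e_k - e_l and their sum; the coefficient of the
    second one, which is negative, is
    - c_(e_k + e_l) = c_(- e_k - e_l) - 1. *)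
Lemma A2_plus_plus F t : reg t ->
  bracket (A j l) (B k l) F t + bracket (B j k) (B k l) F t
  + bracket (A j l) (B j k) F t = 0.
Proof.
move=> rt; have [a0|a0] := eqVneq a 0.
  by rewrite /bracket /minus_op /plus_op /difference /coef_minus /coef_plus /kappa a0 !(mulr0, mul0r, subrr, addr0).
have cN x : expi (2 * x) != 1 -> cfactor (- x) = 1 - cfactor x := @cfactorN R x.
have rD x y : x != y -> expi (2 * (t 0 x - t 0 y)) != 1 by apply: (regular_diff rt a0).
have rS x y : x != y -> expi (2 * (t 0 x + t 0 y)) != 1 by apply: (regular_sum rt a0).
have E G : difference (fun x => - beta k l x) (signed_exchange k l) G = (fun x => - B k l G x).
  by apply/funext => x; rewrite differenceN.
have : bracket (A j l) (difference (fun x => - beta k l x) (signed_exchange k l)) F t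
  + bracket (B j k) (difference (fun x => - beta k l x) (signed_exchange k l)) F t
  - bracket (A j l) (B j k) F t = 0.
  apply: (@bracket_A2 _ _ _ _ _ _ _ _ F t (kappa a) (cfactor (t 0 j + t 0 k))
    (1 - cfactor (t 0 k + t 0 l)) (cfactor (t 0 j - t 0 l)) false true (l < j)%N).
  1-4: by points.
  all: try by coords; rewrite ?subr0.
  - by coords; rewrite addrAC subrr add0r mulrN.
  - by coords; rewrite subr0 opprB addrCA subrr addr0 [t 0 l + _]addrC.
  - by coords; rewrite [_ + t 0 l]addrC -(opprB (t 0 j)) cN ?rD // -mulrN opprB.
  - by coords; rewrite addrAC subrr add0r mulrN [t 0 k + _]addrC.
  - by coords; rewrite -opprD cN // rS.
  - rewrite -cN ?rS // cfactor_mul ?rS ?mulrN ?expiN ?invr_eq1 ?rS //.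
      by rewrite (_ : t 0 j + t 0 k - (t 0 k + t 0 l) = t 0 j - t 0 l) ?subrr ?mulr0 //; ring.
    by rewrite (_ : t 0 j + t 0 k - (t 0 k + t 0 l) = t 0 j - t 0 l) ?rD //; ring.
have AN x y G : A x y (fun u => - G u) t = - A x y G t by exact: difference_opp.
have BN x y G : B x y (fun u => - G u) t = - B x y G t by exact: difference_opp.
rewrite /bracket !E !AN !BN.
move: (minus_op a j l (plus_op a k l F) t) (plus_op a k l (minus_op a j l F) t) (plus_op a j k (plus_op a k l F) t)
  (plus_op a k l (plus_op a j k F) t) (minus_op a j l (plus_op a j k F) t) (plus_op a j k (minus_op a j l F) t).
move=> x1 x2 x3 x4 x5 x6 H; rewrite -[RHS]oppr0 -H; ring.
Qed.

Lemma pair_op_braid F t : reg t ->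
  bracket (X j l) (X k l) F t + bracket (X j k) (X k l) F t + bracket (X j l) (X k j) F t = 0.
Proof.
move=> rt; have := A2_minus_minus F rt; have := A2_minus_plus F rt; have := A2_plus_minus F rt; have := A2_plus_plus F rt.
have EB : B k j = B j k by exact: plus_opC.
have EA c s p e G : reflection s p e ->
    difference c s (A k j G) t = - difference c s (A j k G) t.
  move=> sr; rewrite -difference_opp; apply: (difference_ext _ sr) rt => u ru.
  exact: minus_op_anti.
have EA' c s p e G : reflection s p e ->
    difference c s (A l k G) t = - difference c s (A k l G) t.
  move=> sr; rewrite -difference_opp; apply: (difference_ext _ sr) rt => u ru.
  exact: minus_op_anti.
have er := exchange_reflection; have sr := signed_exchange_reflection.
rewrite /bracket /pair_op {}EB.
rewrite !minus_opD !plus_opD.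
have AA x y G : A x y (A k j G) t = - A x y (A j k G) t := EA _ _ _ _ G (er _ _ _ _).
have BA x y G : B x y (A k j G) t = - B x y (A j k G) t := EA _ _ _ _ G (sr _ _ _ _).
have BA' x y G : B x y (A l k G) t = - B x y (A k l G) t := EA' _ _ _ _ G (sr _ _ _ _).
rewrite !AA !BA !BA' !(minus_op_anti _ rt jk) !(minus_op_anti _ rt kl).
have T (x y z w : R[i]) : x = 0 -> y = 0 -> z = 0 -> w = 0 -> x + y - z + w = 0.
  by move=> -> -> -> ->; rewrite !addr0 subr0.
move=> e4 e3 e2 e1; apply: etrans (T _ _ _ _ e1 e2 e3 e4).
repeat (match goal with |- context [minus_op a ?x ?y ?G t] => move: (minus_op a x y G t) => ?
  | |- context [plus_op a ?x ?y ?G t] => move: (plus_op a x y G t) => ? end).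
ring.
Qed.

End Braid.

End Reflections.

(** * Commutation of the reflection parts *)

Section Planes.
Variables (R : realType) (r : nat) (a b iota : R).
Local Notation V := 'rV[R]_r.
Local Notation reg := (regular a).
Local Notation alpha := (coef_minus a).
Local Notation beta := (coef_plus a).
Local Notation q := (coef_axis b iota).
Local Notation A := (minus_op a).
Local Notation B := (plus_op a).
Local Notation X := (pair_op a).
Local Notation Q := (axis_op b iota).
Local Notation N := (reflection_op a b iota).
Implicit Types (t u : V) (F G : V -> R[i]) (j k l m : 'I_r).

Lemma pair_opD j k F G t : X j k (fun u => F u + G u) t = X j k F t + X j k G t.
Proof.
rewrite /pair_op /minus_op /plus_op !differenceD.
by rewrite addrACA.
Qed.

Lemma pair_op_sum j k (P : pred 'I_r) (F : 'I_r -> V -> R[i]) t :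
  X j k (fun u => \sum_(i < r | P i) F i u) t = \sum_(i < r | P i) X j k (F i) t.
Proof. by rewrite /pair_op /minus_op /plus_op !difference_sum -big_split. Qed.

Lemma axis_opD j F G t : Q j (fun u => F u + G u) t = Q j F t + Q j G t.
Proof. exact: differenceD. Qed.

Lemma axis_op_sum j (P : pred 'I_r) (F : 'I_r -> V -> R[i]) t :
  Q j (fun u => \sum_(i < r | P i) F i u) t = \sum_(i < r | P i) Q j (F i) t.
Proof. exact: difference_sum. Qed.

Lemma bracket_pair_disjoint j l k m F t : j != k -> j != l -> k != m -> j != m -> l != k -> l != m ->
  bracket (X j l) (X k m) F t = 0.
Proof.
move=> jk jl km jm lk lm.
have kj : k != j by rewrite eq_sym. have lj : l != j by rewrite eq_sym.
have mk : m != k by rewrite eq_sym. have mj : m != j by rewrite eq_sym.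
have kl : k != l by rewrite eq_sym. have ml : m != l by rewrite eq_sym.
pose neqs := (negPf jk, negPf jl, negPf km, negPf jm, negPf lk, negPf lm,
 negPf kj, negPf lj, negPf mk, negPf mj, negPf kl, negPf ml).
have pts (s s' : V -> V) : s \in [:: exchange j l; signed_exchange j l] ->
    s' \in [:: exchange k m; signed_exchange k m] -> s (s' t) = s' (s t).
  rewrite !inE => /orP sE /orP sE'.
  apply/rowP => i.
  by case: sE sE' => /eqP -> [] /eqP ->; rewrite ?(coordE, neqs, eqxx);
    case: (eqVneq i j) => E; rewrite ?E ?(neqs, eqxx) //;
    case: (eqVneq i k) => {}E; rewrite ?E ?(neqs, eqxx) //;
    case: (eqVneq i l) => {}E; rewrite ?E ?(neqs, eqxx) //;
    case: (eqVneq i m) => {}E; rewrite ?E ?(neqs, eqxx).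
have AA := @bracket_orthogonal _ V.
have e1 : bracket (A j l) (A k m) F t = 0.
  by apply: AA; rewrite /coef_minus ?(coordE, neqs) // pts // !inE eqxx.
have e2 : bracket (A j l) (B k m) F t = 0.
  by apply: AA; rewrite /coef_minus /coef_plus ?(coordE, neqs) // pts // !inE eqxx ?orbT.
have e3 : bracket (B j l) (A k m) F t = 0.
  by apply: AA; rewrite /coef_minus /coef_plus ?(coordE, neqs) // pts // !inE eqxx ?orbT.
have e4 : bracket (B j l) (B k m) F t = 0.
  by apply: AA; rewrite /coef_plus ?(coordE, neqs) // pts // !inE eqxx ?orbT.
have T (x y z w : R[i]) : x = 0 -> y = 0 -> z = 0 -> w = 0 -> x + y + z + w = 0.
  by move=> -> -> -> ->; rewrite !addr0.
apply: etrans (T _ _ _ _ e1 e2 e3 e4); rewrite /bracket /pair_op !minus_opD !plus_opD.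
repeat (match goal with |- context [minus_op a ?x ?y ?G t] => move: (minus_op a x y G t) => ?
  | |- context [plus_op a ?x ?y ?G t] => move: (plus_op a x y G t) => ? end).
ring.
Qed.

Lemma bracket_axis_pair j k l F t : j != k -> j != l -> bracket (Q j) (X k l) F t = 0.
Proof.
move=> jk jl.
have kj : k != j by rewrite eq_sym. have lj : l != j by rewrite eq_sym.
pose neqs := (negPf jk, negPf jl, negPf kj, negPf lj).
have AA := @bracket_orthogonal _ V.
have e1 : bracket (Q j) (A k l) F t = 0.
  apply: AA; rewrite /coef_minus /coef_axis ?(coordE, neqs) //.
  apply/rowP => i; rewrite ?(coordE, neqs, eqxx).
  case: (eqVneq i j) => E; rewrite ?E ?(neqs, eqxx) //.
have e2 : bracket (Q j) (B k l) F t = 0.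
  apply: AA; rewrite /coef_plus /coef_axis ?(coordE, neqs) //.
  apply/rowP => i; rewrite ?(coordE, neqs, eqxx).
  case: (eqVneq i j) => E; rewrite ?E ?(neqs, eqxx) //.
apply: etrans (_ : bracket (Q j) (A k l) F t + bracket (Q j) (B k l) F t = 0); last first.
  by rewrite e1 e2 addr0.
rewrite /bracket /pair_op axis_opD.
repeat (match goal with |- context [minus_op a ?x ?y ?G t] => move: (minus_op a x y G t) => ?
  | |- context [plus_op a ?x ?y ?G t] => move: (plus_op a x y G t) => ?
  | |- context [axis_op b iota ?y ?G t] => move: (axis_op b iota y G t) => ? end).
ring.
Qed.

(** The part of D_j in the plane of e_j and e_k. *)
Definition plane_op j k F t := X j k F t + Q j F t.

Lemma bracket_plane j k F t : reg t -> j != k -> bracket (plane_op j k) (plane_op k j) F t = 0.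
Proof.
move=> rt jk; have kj : k != j by rewrite eq_sym.
pose neqs := (negPf jk, negPf kj).
pose P1 G x := difference (alpha j k) (exchange j k) G x + difference (beta j k) (signed_exchange j k) G x + difference (q j) (sign_change j) G x.
pose P2 G x := - difference (alpha j k) (exchange j k) G x + difference (beta j k) (signed_exchange j k) G x + difference (q k) (sign_change k) G x.
have EB : B k j = B j k by exact: plus_opC.
have E1 G u : plane_op j k G u = P1 G u by [].
have E2 G u : reg u -> plane_op k j G u = P2 G u.
  by move=> ru; rewrite /plane_op /pair_op (minus_op_anti _ ru jk) EB.
have E1' G H u : reg u -> (forall v, reg v -> G v = H v) -> plane_op j k G u = P1 H u.
  move=> ru GH; rewrite E1 /P1.
  rewrite (difference_ext _ (@exchange_reflection R r j k) GH ru).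
  rewrite (difference_ext _ (@signed_exchange_reflection R r j k) GH ru).
  by rewrite (difference_ext _ (@sign_change_reflection R r j) GH ru).
rewrite /bracket (E1' _ (P2 F)) // => [|v rv]; last exact: E2.
rewrite E2 // (_ : plane_op j k F = P1 F); last by apply/funext => u; rewrite E1.
have [a0|a0] := eqVneq a 0.
  have A0 x y G u : difference (alpha x y) (exchange x y) G u = 0.
    by rewrite /difference /coef_minus /kappa a0 !(mulr0, mul0r).
  have B0 x y G u : difference (beta x y) (signed_exchange x y) G u = 0.
    by rewrite /difference /coef_plus /kappa a0 !(mulr0, mul0r).
  rewrite /P1 /P2 !A0 !B0 !oppr0 !add0r.
  rewrite (_ : (fun x => _ + difference (q k) _ _ x) = difference (q k) (sign_change k) F); last first.
    by apply/funext => u; rewrite A0 B0 oppr0 !add0r.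
  rewrite (_ : (fun x => _ + difference (q j) _ _ x) = difference (q j) (sign_change j) F); last first.
    by apply/funext => u; rewrite A0 B0 !add0r.
  apply: (@bracket_orthogonal _ V (q j) (sign_change j) (q k) (sign_change k)).
  - by rewrite /coef_axis ?(coordE, neqs).
  - by rewrite /coef_axis ?(coordE, neqs).
  - apply/rowP => i; rewrite ?(coordE, neqs, eqxx).
    by case: (eqVneq i j) => E; rewrite ?E ?(neqs, eqxx).
have cN x : expi (2 * x) != 1 -> cfactor (- x) = 1 - cfactor x := @cfactorN R x.
have rD x y : x != y -> expi (2 * (t 0 x - t 0 y)) != 1 by apply: (regular_diff rt a0).
have rS x y : x != y -> expi (2 * (t 0 x + t 0 y)) != 1 by apply: (regular_sum rt a0).
pose M : R[i] := 2 * 'i%C * iota%:C + 2 * 'i%C * b%:C.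
have qN x : expi (2 * t 0 x) != 1 -> expi (2 * (2 * t 0 x)) != 1 ->
    2 * 'i%C * iota%:C * cfactor (2 * - t 0 x) + 2 * 'i%C * b%:C * cfactor (- t 0 x) = M - q x t.
  by move=> x1 x2; rewrite mulrN !cN // /M /coef_axis; ring.
have r4 x : expi (2 * (2 * t 0 x)) != 1 by exact: regular_quadruple rt.
have r2 x : expi (2 * t 0 x) != 1 by exact: regular_single rt.
apply: (@bracket_BC2 _ V _ _ _ _ _ _ _ _ F t (kappa a) (cfactor (t 0 j - t 0 k))
  (cfactor (t 0 j + t 0 k)) (k < j)%N%:R M).
1-9: by apply/rowP => i; rewrite ?(coordE, neqs, eqxx);
     case: (eqVneq i j) => E; rewrite ?E ?(neqs, eqxx) ?opprK //;
     case: (eqVneq i k) => {}E; rewrite ?E ?(neqs, eqxx) ?opprK.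
all: rewrite ?/coef_minus ?/coef_plus ?(coordE, neqs, eqxx) ?opprK //.
- by rewrite [- t 0 k + _]addrC.
- by rewrite -opprD cN // rS.
- by rewrite [t 0 k + _]addrC.
- by rewrite addrC -(opprB (t 0 j)) cN // rD.
- by rewrite /coef_axis !(coordE, eqxx).
- by rewrite /coef_axis !(coordE, neqs, eqxx).
- by rewrite /coef_axis !(coordE, neqs, eqxx) -qN.
- by rewrite /coef_axis !(coordE, neqs, eqxx) -qN.
- by rewrite /coef_axis !(coordE, neqs, eqxx).
- by rewrite /coef_axis !(coordE, neqs, eqxx).
rewrite /coef_axis /M /cfactor.
have E2x x : expi (- 2 * (2 * x)) = (expi (2 * x) ^+ 2)^-1.
  by rewrite mulNr expiN expr2 -expiD; congr ((expi _)^-1); ring.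
have E1x x : expi (- 2 * x) = (expi (2 * x))^-1 by rewrite mulNr expiN.
have ED x y : expi (2 * (x + y)) = expi (2 * x) * expi (2 * y) by rewrite mulrDr expiD.
have EN x : expi (2 * - x) = (expi (2 * x))^-1 by rewrite mulrN expiN.
rewrite !E2x !E1x !ED !EN.
have zwD := rD j k jk; have zwS := rS j k jk; rewrite ED EN in zwD; rewrite ED in zwS.
have z0 := expi_neq0 (2 * t 0 j); have w0 := expi_neq0 (2 * t 0 k).
have z1 := r2 j; have w1 := r2 k.
have z2 := regular_double j rt; have w2 := regular_double k rt.
move: (expi (2 * t 0 j)) (expi (2 * t 0 k)) z0 w0 z1 w1 z2 w2 zwD zwS.
move: (2 * 'i%C * iota%:C) (2 * 'i%C * b%:C) (kappa a) => p s kap z w z0 w0 z1 w1 z2 w2 zwD zwS.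
have zw : z != w by apply: contraNneq zwD => ->; rewrite divff.
by rewrite BC2_relation ?mulr0.
Qed.

Lemma reflection_op_split j k F t : k != j ->
  N j F t = plane_op j k F t + \sum_(l < r | (l != j) && (l != k)) X j l F t.
Proof.
by move=> kj; rewrite /reflection_op (bigD1 k) //= /plane_op addrAC.
Qed.

Lemma plane_opD j k F G t : plane_op j k (fun u => F u + G u) t = plane_op j k F t + plane_op j k G t.
Proof. by rewrite /plane_op pair_opD axis_opD addrACA. Qed.

Lemma plane_op_sum j k (P : pred 'I_r) (F : 'I_r -> V -> R[i]) t :
  plane_op j k (fun u => \sum_(i < r | P i) F i u) t = \sum_(i < r | P i) plane_op j k (F i) t.
Proof. by rewrite /plane_op pair_op_sum axis_op_sum -big_split. Qed.

(** Compares two sums over pairs (i, i') after exchanging the two indices on one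
    side, when the comparison holds for each i separately. *)
Lemma eq_split_sums (W : nmodType) (I : finType) (P : pred I) (x y : W)
    (f g f' g' : I -> W) (h h' : I -> I -> W) :
  x = y ->
  (forall i, P i -> f i + (g i + \sum_(i' | P i') h i i') =
                    f' i + (g' i + \sum_(i' | P i') h' i' i)) ->
  x + \sum_(i | P i) f i + \sum_(i | P i) (g i + \sum_(i' | P i') h i i') =
  y + \sum_(i | P i) f' i + \sum_(i | P i) (g' i + \sum_(i' | P i') h' i i').
Proof.
move=> -> fg; rewrite -!addrA; congr (_ + _); rewrite -big_split /=.
rewrite (eq_bigr _ fg) !big_split /=; congr (_ + (_ + _)).
exact: exchange_big.
Qed.

(** Splitting off the plane of e_j and e_k, the products with a third index l are
    compared for each l: this is the relation of type D3, plus the commutation of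
    the terms of l with those of the remaining indices. *)
Lemma reflection_opC j k F t : reg t -> N j (N k F) t = N k (N j F) t.
Proof.
move=> rt; have [->//|jk] := eqVneq j k; have kj : k != j by rewrite eq_sym.
pose P l := (l != j) && (l != k).
have PE : (fun l => (l != k) && (l != j)) =1 P by move=> l; rewrite /P andbC.
have Nj G : N j G = fun u => plane_op j k G u + \sum_(l < r | P l) X j l G u.
  by apply/funext => u; rewrite (reflection_op_split _ _ kj).
have Nk G : N k G = fun u => plane_op k j G u + \sum_(l < r | P l) X k l G u.
  by apply/funext => u; rewrite (reflection_op_split _ _ jk) (eq_bigl _ _ PE).
rewrite !Nj !Nk plane_opD plane_op_sum [in RHS]plane_opD [in RHS]plane_op_sum.
have EX x (G : V -> R[i]) (H : 'I_r -> V -> R[i]) l :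
    X x l (fun u => G u + \sum_(m < r | P m) H m u) t =
    X x l G t + \sum_(m < r | P m) X x l (H m) t.
  by rewrite pair_opD pair_op_sum.
have ZZ : plane_op j k (plane_op k j F) t = plane_op k j (plane_op j k F) t.
  by apply/eqP; rewrite -subr_eq0; apply/eqP; exact: bracket_plane.
have EXj : \sum_(l < r | P l) X j l (fun u => plane_op k j F u + \sum_(m < r | P m) X k m F u) t
    = \sum_(l < r | P l) (X j l (plane_op k j F) t + \sum_(m < r | P m) X j l (X k m F) t).
  by apply: eq_bigr => l _; exact: EX.
have EXk : \sum_(l < r | P l) X k l (fun u => plane_op j k F u + \sum_(m < r | P m) X j m F u) t
    = \sum_(l < r | P l) (X k l (plane_op j k F) t + \sum_(m < r | P m) X k l (X j m F) t).
  by apply: eq_bigr => l _; exact: EX.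
rewrite EXj EXk.
apply: eq_split_sums ZZ _ => l /andP[lj lk].
have jl : j != l by rewrite eq_sym. have kl : k != l by rewrite eq_sym.
have Pl : P l by rewrite /P lj.
rewrite (bigD1 l) //= [in RHS](bigD1 l) //=.
have -> : \sum_(m < r | P m && (m != l)) X j l (X k m F) t =
    \sum_(m < r | P m && (m != l)) X k m (X j l F) t.
  apply: eq_bigr => m /andP[/andP[mj mk] ml].
  apply/eqP; rewrite -subr_eq0; apply/eqP.
  by apply: bracket_pair_disjoint; rewrite // eq_sym.
have T (f g h f' g' h' s : R[i]) : f + g + h = f' + g' + h' ->
    f + (g + (h + s)) = f' + (g' + (h' + s)) by rewrite !addrA => ->.
apply: T.
have /eqP := pair_op_braid jk jl kl F rt.
have /eqP := @bracket_axis_pair j k l F t jk jl; have /eqP := @bracket_axis_pair k j l F t kj kl.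
rewrite /bracket !subr_eq0 => /eqP Qk /eqP Qj B3.
rewrite /plane_op Qj (_ : X k l (fun u => X j k F u + Q j F u) t = X k l (X j k F) t + X k l (Q j F) t); last exact: pair_opD.
rewrite (_ : X j l (fun u => X k j F u + Q k F u) t = X j l (X k j F) t + X j l (Q k F) t); last exact: pair_opD.
rewrite -Qk; apply/eqP; rewrite -subr_eq0 -(eqP B3); apply/eqP.
repeat (match goal with |- context [pair_op a ?x ?y ?G t] => move: (pair_op a x y G t) => ?
  | |- context [axis_op b iota ?y ?G t] => move: (axis_op b iota y G t) => ? end).
ring.
Qed.

End Planes.

(** * Commutation of the Cherednik operators *)

Section Commutation.
Variables (R : realType) (r : nat) (a b iota : R).
Local Notation V := 'rV[R]_r.
Local Notation reg := (regular a).
Local Notation smooth := (@smooth R r a).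
Local Notation scst := (@smooth_cst R r a).
Local Notation alpha := (coef_minus a).
Local Notation beta := (coef_plus a).
Local Notation q := (coef_axis b iota).
Local Notation A := (minus_op a).
Local Notation B := (plus_op a).
Local Notation X := (pair_op a).
Local Notation Q := (axis_op b iota).
Local Notation N := (reflection_op a b iota).
Local Notation D := (cherednik_fun a b iota).
Implicit Types (t u : V) (F G : V -> R[i]) (j k l m : 'I_r).

Local Opaque partial.

(** The derivative along t_j is proportional to the coordinate x_j of the root,
    with a factor h independent of j; hence the coefficients of e_j - e_k and
    e_j + e_k are killed by d_j + d_k and d_j - d_k. *)
Lemma smooth_cfactor (x : V) (g : V -> R) : (forall t, dotv t x = g t) ->
  (forall t, reg t -> expi (2 * g t) != 1) ->
  smooth (fun t => cfactor (g t)) /\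
  exists h : V -> R[i], forall j t, reg t ->
    partial j (fun t => cfactor (g t)) t = (x 0 j)%:C * h t.
Proof.
move=> gE g1.
pose d t : R[i] := 1 + (-1) * expi (dotv t (- 2 *: x)).
have dE t : cfactor (g t) = (d t)^-1 by rewrite /d dotvZr gE mulN1r.
have d0 t : reg t -> d t != 0.
  move=> /g1; rewrite /d dotvZr gE mulN1r mulNr expiN subr_eq0 [1 == _]eq_sym.
  by rewrite invr_eq1.
have sE := smooth_expi a (- 2 *: x).
have sd : smooth d by apply: smoothD; [exact: smooth_cst|apply: smoothM => //; exact: smooth_cst].
have sV := smoothV sd d0.
split; first by apply: smooth_ext sV _ => t _; rewrite dE.
exists (fun t => - (d t)^-1 ^+ 2 * (2 * 'i%C * expi (dotv t (- 2 *: x)))) => j t rt.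
rewrite (partial_ext (G := fun t => (d t)^-1) j _ rt) => [|u _]; last exact: dE.
rewrite (partialV j sd (d0 _ rt) rt) [X in _ * X = _](_ : _ =
  (x 0 j)%:C * (2 * 'i%C * expi (dotv t (- 2 *: x)))); first by rewrite mulrCA.
rewrite (partialD j (scst 1) (smoothM (scst (-1)) sE) rt) partial_cst add0r.
rewrite (partialM j (scst (-1)) sE rt) partial_cst mulr0 addr0 partial_expi mxE.
rewrite rmorphM rmorphN /= (_ : (2%:C : R[i]) = 2); last by rewrite rmorph_nat.
by move: (expi _) ((x 0 j)%:C) => ? ?; ring.
Qed.

Lemma smooth_coef_minus j k : j != k -> smooth (alpha j k) /\
  exists h : V -> R[i], forall l t, reg t ->
    partial l (alpha j k) t = ((l == j)%:R - (l == k)%:R) * h t.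
Proof.
move=> jk; have [a0|a0] := eqVneq a 0.
  have E t : alpha j k t = 0 by rewrite /coef_minus /kappa a0 mulr0 mul0r.
  split; first by apply: smooth_ext (scst 0) _ => t _; rewrite E.
  exists (fun=> 0) => l t rt; rewrite mulr0 -[RHS](partial_cst l 0 t).
  by apply: partial_ext rt => u _; rewrite E.
have gE t : dotv t (eps R j + (-1) *: eps R k) = t 0 j - t 0 k.
  by rewrite dotvDr dotvZr !dotv_eps mulN1r.
have [sc [h hE]] := smooth_cfactor gE (fun t rt => regular_diff rt a0 jk).
have sk := scst (kappa a); have sn := scst (- (k < j)%N%:R).
split; first exact: smoothM sk (smoothD sc sn).
exists (fun t => kappa a * h t) => l t rt.
rewrite (partialM l sk (smoothD sc sn) rt) (partialD l sc sn rt) !partial_cst (hE l t rt).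
rewrite !mxE /= ?eqxx /= addr0 mulr0 addr0 mulrCA rmorphD rmorphM rmorphN1 mulN1r /= !rmorph_nat.
by [].
Qed.

Lemma smooth_coef_plus j k : j != k -> smooth (beta j k) /\
  exists h : V -> R[i], forall l t, reg t ->
    partial l (beta j k) t = ((l == j)%:R + (l == k)%:R) * h t.
Proof.
move=> jk; have [a0|a0] := eqVneq a 0.
  have E t : beta j k t = 0 by rewrite /coef_plus /kappa a0 mulr0 mul0r.
  split; first by apply: smooth_ext (scst 0) _ => t _; rewrite E.
  exists (fun=> 0) => l t rt; rewrite mulr0 -[RHS](partial_cst l 0 t).
  by apply: partial_ext rt => u _; rewrite E.
have gE t : dotv t (eps R j + eps R k) = t 0 j + t 0 k.
  by rewrite dotvDr !dotv_eps.
have [sc [h hE]] := smooth_cfactor gE (fun t rt => regular_sum rt a0 jk).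
have sk := scst (kappa a).
split; first exact: smoothM sk sc.
exists (fun t => kappa a * h t) => l t rt.
rewrite (partialM l sk sc rt) !partial_cst (hE l t rt).
by rewrite !mxE /= ?eqxx /= mulr0 addr0 mulrCA rmorphD /= !rmorph_nat.
Qed.

Lemma smooth_coef_axis j : smooth (q j) /\
  forall l t, reg t -> l != j -> partial l (q j) t = 0.
Proof.
have gE t : dotv t (eps R j) = t 0 j by rewrite dotv_eps.
have gE2 t : dotv t (2 *: eps R j) = 2 * t 0 j by rewrite dotvZr gE.
have [sc [h hE]] := smooth_cfactor gE (fun t rt => regular_single j rt).
have [sc2 [h2 hE2]] := smooth_cfactor gE2 (fun t rt => regular_quadruple j rt).
have s1 := scst (2 * 'i%C * iota%:C); have s2 := scst (2 * 'i%C * b%:C).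
have s3 := smoothM s1 sc2; have s4 := smoothM s2 sc.
split; first exact: smoothD s3 s4.
move=> l t rt lj; rewrite (partialD l s3 s4 rt) (partialM l s1 sc2 rt) (partialM l s2 sc rt).
by rewrite (hE l t rt) (hE2 l t rt) !partial_cst !mxE (negPf lj) andbF !mulr0n !mulr0 !mul0r !mulr0 !addr0.
Qed.

Section Difference.
Variables (c : V -> R[i]) (w : V -> V) (p : 'I_r -> 'I_r) (e : 'I_r -> bool).
Hypotheses (sc : smooth c) (wr : reflection w p e).

Lemma smooth_difference F : smooth F -> smooth (difference c w F).
Proof.
move=> sF; apply: smoothM => //; apply: (smooth_ext (smoothD sF (smoothM (scst (-1)) (smooth_reflection wr sF)))).
by move=> t _; rewrite mulN1r.
Qed.

(** The bracket of d_j with a difference operator. *)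
Lemma partial_difference j F t : smooth F -> reg t ->
  partial j (difference c w F) t =
  partial j c t * (F t - F (w t)) +
  c t * (partial j F t - (-1) ^+ e j * partial (p j) F (w t)).
Proof.
move=> sF rt; have sFw := smooth_reflection wr sF.
have s1 := scst (-1).
rewrite (partial_ext (G := fun u => c u * (F u + (-1) * F (w u))) j _ rt) => [|u _]; last first.
  by rewrite mulN1r.
rewrite (partialM j sc (smoothD sF (smoothM s1 sFw)) rt) (partialD j sF (smoothM s1 sFw) rt).
rewrite (partialM j s1 sFw rt) partial_cst (partial_reflection j sF wr rt) mulr0 addr0.
by rewrite !mulN1r addrC; congr (_ + _); rewrite mulrC.
Qed.

End Difference.

Lemma smooth_minus_op j k F : j != k -> smooth F -> smooth (A j k F).
Proof.
move=> jk sF; have [sa _] := smooth_coef_minus jk.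
rewrite /minus_op; exact (smooth_difference sa (exchange_reflection R j k) sF).
Qed.

Lemma smooth_plus_op j k F : j != k -> smooth F -> smooth (B j k F).
Proof.
move=> jk sF; have [sa _] := smooth_coef_plus jk.
rewrite /plus_op; exact (smooth_difference sa (signed_exchange_reflection R j k) sF).
Qed.

Lemma smooth_pair_op j k F : j != k -> smooth F -> smooth (X j k F).
Proof. by move=> jk sF; apply: smoothD; [exact: smooth_minus_op|exact: smooth_plus_op]. Qed.

Lemma smooth_axis_op j F : smooth F -> smooth (Q j F).
Proof.
by move=> sF; have [sq _] := smooth_coef_axis j; rewrite /axis_op; exact (smooth_difference sq (sign_change_reflection R j) sF).
Qed.

Section SumCond.
Variables (P : pred 'I_r) (F : 'I_r -> V -> R[i]).
Hypothesis sF : forall k, P k -> smooth (F k).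
Let F' k := if P k then F k else fun=> 0.

Let sF' k : smooth (F' k).
Proof. by rewrite /F'; case: ifP => [/sF//|_]; exact: smooth_cst. Qed.

Let FE t : \sum_(k < r | P k) F' k t = \sum_(k < r | P k) F k t.
Proof. by apply: eq_bigr => k Pk; rewrite /F' Pk. Qed.

Lemma smooth_sumP : smooth (fun t => \sum_(k < r | P k) F k t).
Proof. by apply: smooth_ext (smooth_sum (index_enum _) P sF') _ => t _; rewrite FE. Qed.

Lemma partial_sumP j t : reg t ->
  partial j (fun u => \sum_(k < r | P k) F k u) t = \sum_(k < r | P k) partial j (F k) t.
Proof.
move=> rt; rewrite -(partial_ext (F := fun u => \sum_(k < r | P k) F' k u) j _ rt) => [|u _].
  rewrite (partial_sum (index_enum _) P j sF' rt).
  by apply: eq_bigr => k Pk; rewrite /F' Pk.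
by rewrite FE.
Qed.

End SumCond.

Lemma smooth_reflection_op j F : smooth F -> smooth (N j F).
Proof.
move=> sF; apply: smoothD; last exact: smooth_axis_op.
by apply: smooth_sumP => k kj; apply: smooth_pair_op; rewrite // eq_sym.
Qed.

Lemma minus_op_partial j k l F t : smooth F -> reg t -> k != l -> j != k -> j != l ->
  partial j (A k l F) t = A k l (partial j F) t.
Proof.
move=> sF rt kl jk jl; have [sa [h hE]] := smooth_coef_minus kl.
rewrite /minus_op (partial_difference sa (exchange_reflection R k l) j sF rt) (hE j t rt).
by rewrite (negPf jk) (negPf jl) subrr !mul0r add0r expr0 mul1r tpermD // eq_sym.
Qed.

Lemma plus_op_partial j k l F t : smooth F -> reg t -> k != l -> j != k -> j != l ->
  partial j (B k l F) t = B k l (partial j F) t.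
Proof.
move=> sF rt kl jk jl; have [sa [h hE]] := smooth_coef_plus kl.
rewrite /plus_op (partial_difference sa (signed_exchange_reflection R k l) j sF rt) (hE j t rt).
rewrite (negPf jk) (negPf jl) addr0 !mul0r add0r expr0 mul1r tpermD //; by rewrite eq_sym.
Qed.

Lemma pair_op_partial j k l F t : smooth F -> reg t -> k != l -> j != k -> j != l ->
  partial j (X k l F) t = X k l (partial j F) t.
Proof.
move=> sF rt kl jk jl.
rewrite /pair_op -(minus_op_partial sF rt kl jk jl) -(plus_op_partial sF rt kl jk jl).
exact (partialD j (smooth_minus_op kl sF) (smooth_plus_op kl sF) rt).
Qed.

Lemma axis_op_partial j k F t : smooth F -> reg t -> j != k ->
  partial j (Q k F) t = Q k (partial j F) t.
Proof.
move=> sF rt jk; have [sq qE] := smooth_coef_axis k.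
rewrite /axis_op (partial_difference sq (sign_change_reflection R k) j sF rt) (qE j t rt jk).
by rewrite mul0r add0r (negPf jk) expr0 mul1r.
Qed.

(** The bracket of d_j with D_k; only the terms of D_k in e_k - e_j and e_k + e_j
    contribute. *)
Definition mixed_term j k F t := partial j (X k j F) t - X k j (partial j F) t.

Lemma mixed_termC j k F t : smooth F -> reg t -> j != k -> mixed_term j k F t = mixed_term k j F t.
Proof.
move=> sF rt jk; have kj : k != j by rewrite eq_sym.
have [sa [h hE]] := smooth_coef_minus jk.
have [sb [h' hE']] := smooth_coef_plus jk.
have EB : B k j = B j k by exact: plus_opC.
have sA := smooth_minus_op jk sF; have sB := smooth_plus_op jk sF.
have sA' := smoothM (scst (-1)) sA.
rewrite /mixed_term /pair_op EB (minus_op_anti _ rt jk).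
rewrite (partial_ext (G := fun u => (-1) * A j k F u + B j k F u) j _ rt) => [|u ru]; last first.
  by rewrite (minus_op_anti _ ru jk) mulN1r.
rewrite (partialD j sA' sB rt) (partialM j (scst (-1)) sA rt) partial_cst.
rewrite (partialD k sA sB rt).
rewrite /minus_op (partial_difference sa (exchange_reflection R j k) j sF rt) (hE j t rt).
rewrite (partial_difference sa (exchange_reflection R j k) k sF rt) (hE k t rt).
rewrite /plus_op (partial_difference sb (signed_exchange_reflection R j k) j sF rt) (hE' j t rt).
rewrite (partial_difference sb (signed_exchange_reflection R j k) k sF rt) (hE' k t rt).
rewrite !eqxx (negPf jk) (negPf kj) tpermL tpermR orbT /= !expr0 !expr1 /difference.
move: (alpha j k t) (beta j k t) (h t) (h' t) => x y z w.
move: (partial j F) (partial k F) => Fj Fk.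
move: (F t) (F (exchange j k t)) (F (signed_exchange j k t)) => f1 f2 f3.
move: (Fj t) (Fj (exchange j k t)) (Fj (signed_exchange j k t)) => f4 f5 f6.
move: (Fk t) (Fk (exchange j k t)) (Fk (signed_exchange j k t)) => f7 f8 f9.
by rewrite !mulr1n !mulr0n; ring.
Qed.

Lemma reflection_op_partial j k F t : smooth F -> reg t -> j != k ->
  partial j (N k F) t = N k (partial j F) t + mixed_term j k F t.
Proof.
move=> sF rt jk; have kj : k != j by rewrite eq_sym.
have sX l : (l != k) && (l != j) -> smooth (X k l F).
  by case/andP => lk _; apply: smooth_pair_op; rewrite // eq_sym.
have sXkj := smooth_pair_op kj sF; have sQ := smooth_axis_op k sF.
rewrite (partial_ext (G := fun u => (X k j F u + Q k F u) +
  \sum_(l < r | (l != k) && (l != j)) X k l F u) j _ rt) => [|u _]; last first.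
  by rewrite (reflection_op_split _ _ _ _ _ jk).
rewrite (partialD j (smoothD sXkj sQ) (smooth_sumP sX) rt) (partialD j sXkj sQ rt).
rewrite (partial_sumP sX j rt) (axis_op_partial sF rt jk) (reflection_op_split _ _ _ _ _ jk) /plane_op.
rewrite [X in _ + X = _](eq_bigr (fun l => X k l (partial j F) t)); last first.
  by move=> l /andP[lk lj]; apply: pair_op_partial; rewrite // eq_sym.
rewrite /mixed_term; move: (partial j (X k j F) t) (X k j (partial j F) t) (\sum_(i | _) _) (Q k _ t) => *.
ring.
Qed.

Lemma smooth_cherednik j F : smooth F -> smooth (D j F).
Proof.
move=> sF; have s1 := smoothD (smooth_partial j sF) (smooth_reflection_op j sF).
have s2 := smoothM (scst (- ('i%C * (rho r a b iota j.+1)%:C))) sF.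
by apply: smooth_ext (smoothD s1 s2) _ => t rt; rewrite cherednikE // mulNr.
Qed.

Lemma reflection_op_ext j F G t : (forall u, reg u -> F u = G u) -> reg t -> N j F t = N j G t.
Proof.
move=> FG rt; rewrite /reflection_op /pair_op /minus_op /plus_op /axis_op; congr (_ + _).
  apply: eq_bigr => k _; congr (_ + _).
    exact (difference_ext _ (exchange_reflection R j k) FG rt).
  exact (difference_ext _ (signed_exchange_reflection R j k) FG rt).
exact (difference_ext _ (sign_change_reflection R j) FG rt).
Qed.

Lemma cherednik_ext j F G t : (forall u, reg u -> F u = G u) -> reg t -> D j F t = D j G t.
Proof.
by move=> FG rt; rewrite !cherednikE // (reflection_op_ext j FG rt) (partial_ext j FG rt) (FG t rt).
Qed.

Lemma reflection_opD j F G t : N j (fun u => F u + G u) t = N j F t + N j G t.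
Proof.
rewrite /reflection_op axis_opD (eq_bigr (fun k => X j k F t + X j k G t)) => [|k _]; last exact: pair_opD.
by rewrite big_split /= addrACA.
Qed.

Lemma reflection_opZ j (c : R[i]) F t : N j (fun u => c * F u) t = c * N j F t.
Proof.
rewrite /reflection_op /pair_op /minus_op /plus_op /axis_op differenceZ mulrDr; congr (_ + _).
by rewrite mulr_sumr; apply: eq_bigr => k _; rewrite !differenceZ mulrDr.
Qed.

(** The differential and the reflection parts cancel separately: the former by
    [mixed_termC], the latter by [reflection_opC]. *)
Theorem cherednikC j k F t : smooth F -> reg t -> D j (D k F) t = D k (D j F) t.
Proof.
move=> sF rt; have [->//|jk] := eqVneq j k; have kj : k != j by rewrite eq_sym.
pose cc l : R[i] := - ('i%C * (rho r a b iota l.+1)%:C).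
have E l u : reg u -> D l F u = partial l F u + N l F u + cc l * F u.
  by move=> ru; rewrite cherednikE // /cc mulNr.
have sp l := smooth_partial l sF; have sN l := smooth_reflection_op l sF.
have sc l := smoothM (scst (cc l)) sF.
have EE l m : D l (D m F) t =
    partial l (partial m F) t + partial l (N m F) t + cc m * partial l F t
    + (N l (partial m F) t + N l (N m F) t + cc m * N l F t)
    + cc l * (partial m F t + N m F t + cc m * F t).
  rewrite (cherednik_ext l (E m) rt) cherednikE // -mulNr -/(cc l).
  rewrite (partialD l (smoothD (sp m) (sN m)) (sc m) rt) (partialD l (sp m) (sN m) rt).
  rewrite (partialM l (scst (cc m)) sF rt) partial_cst mulr0 addr0.
  by rewrite reflection_opD reflection_opD reflection_opZ.
rewrite !EE (partialC j k sF rt) (reflection_op_partial sF rt jk) (reflection_op_partial sF rt kj).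
rewrite (mixed_termC sF rt jk) (reflection_opC b iota j k F rt).
move: (N k (N j F) t) (mixed_term k j F t) (partial k (partial j F) t) => x1 x2 x3.
move: (partial j F) (partial k F) => Fj Fk.
move: (N k Fj t) (N j Fk t) (N j F t) (N k F t) (Fj t) (Fk t) (F t) (cc j) (cc k) => *.
ring.
Qed.

End Commutation.

(** * Difference quotients in one and two variables *)

Section Cayley.
Variable K : fieldType.
Implicit Types x y p q : K.

Definition cayley x : K := x / (1 + x).
Definition cocayley x : K := (1 + x)^-1.

Lemma cayleyV x : x != 0 -> 1 + x != 0 -> cayley x^-1 = cocayley x.
Proof.
move=> x0 x1; rewrite /cayley /cocayley; field.
by rewrite ?x0 ?x1 ?[x + 1]addrC ?x1.
Qed.

Lemma cocayleyV x : x != 0 -> 1 + x != 0 -> cocayley x^-1 = cayley x.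
Proof.
move=> x0 x1; rewrite /cayley /cocayley; field.
by rewrite ?x0 ?x1 ?[x + 1]addrC ?x1.
Qed.

Lemma cocayleyE x : 1 + x != 0 -> cocayley x = 1 - cayley x.
Proof. by move=> x1; rewrite /cayley /cocayley; field. Qed.

(** With x and y the coordinates of indices m and k, the next four identities
    compute the terms of D_m in e_m - e_k and e_m + e_k together (or in e_m) on
    the monomials of [cherednik_raise] and [cherednik_lower]. *)
Lemma raise_lt x y : x != 0 -> y != 0 -> 1 + x != 0 -> 1 + y != 0 -> x != y -> x * y != 1 ->
  ((1 - y * x^-1)^-1 - 1) * (cayley y - cayley x)
  + (1 - (x * y)^-1)^-1 * (cayley y - cayley x^-1) = (2 * cayley x - 1) * cayley y.
Proof.
move=> x0 y0 x1 y1 xy xy1; rewrite cayleyV // /cayley /cocayley; field.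
by rewrite x0 y0 x1 y1 !subr_eq0 xy xy1.
Qed.

Lemma lower_lt x y : x != 0 -> y != 0 -> 1 + x != 0 -> 1 + y != 0 -> x * y != 1 ->
  (1 - (x * y)^-1)^-1 * (cayley x * cayley y - cayley y^-1 * cayley x^-1) = cayley x * cayley y.
Proof.
move=> x0 y0 x1 y1 xy1; rewrite !cayleyV // /cayley /cocayley; field.
by rewrite x0 y0 x1 y1 !subr_eq0 xy1.
Qed.

Lemma lower_gt x y : x != 0 -> y != 0 -> 1 + x != 0 -> 1 + y != 0 -> x != y -> x * y != 1 ->
  (1 - y * x^-1)^-1 * (cayley x * (cayley y * cocayley y) - cayley y * (cayley x * cocayley x))
  + (1 - (x * y)^-1)^-1 * (cayley x * (cayley y * cocayley y)
                           - cayley y^-1 * (cayley x^-1 * cocayley x^-1))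
  = 2 * cayley x * (cayley x * (cayley y * cocayley y)).
Proof.
move=> x0 y0 x1 y1 xy xy1; rewrite !cayleyV // !cocayleyV // /cayley /cocayley; field.
by rewrite x0 y0 x1 y1 !subr_eq0 xy xy1.
Qed.

Lemma lower_single p q x : x != 0 -> 1 + x != 0 -> x != 1 ->
  (p * (1 - x^-1)^-1 + q * (1 + x^-1)^-1) * (cayley x - cayley x^-1)
  = (p + q * (2 * cayley x - 1)) * cayley x.
Proof.
move=> x0 x1 xn1; rewrite !cayleyV // /cayley /cocayley; field.
by rewrite x0 x1 !subr_eq0 xn1 ?x1.
Qed.

End Cayley.
(** * Raising and lowering *)

Section Shift.
Variables (R : realType) (r : nat) (a b iota delta : R).
Local Notation V := 'rV[R]_r.
Local Notation reg := (regular a).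
Local Notation smooth := (@smooth R r a).
Local Notation A := (minus_op a).
Local Notation B := (plus_op a).
Local Notation Q := (axis_op b iota).
Local Notation D := (cherednik_fun a b iota).
Implicit Types (t u : V) (F G : V -> R[i]) (j k l m : 'I_r).

Local Opaque partial.

(* The cosine is the case sg = 1, (p, q) = (iota + 2b, iota); the sine is the
   case sg = -1, (p, q) = (iota, iota + 2b). *)
Variables (sg : R[i]) (p q : R) (f : V -> R[i]).
Hypothesis sg2 : sg * sg = 1.
Hypothesis pq : p + q = 2 * (iota + b).

Definition torus_coord j t : R[i] := sg * expi (2 * t 0 j).

Hypothesis coef_axisE : forall j t, reg t ->
  coef_axis b iota j t =
  'i%C * (p%:C * (1 - (torus_coord j t)^-1)^-1 + q%:C * (1 + (torus_coord j t)^-1)^-1).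
Hypothesis f_inv : forall w pi e, reflection w pi e -> forall t, f (w t) = f t.
Hypothesis f_partial : forall j t, reg t -> has_partial j f t
  ('i%C * delta%:C * (2 * cayley (torus_coord j t) - 1) * f t).

Lemma sg_neq0 : sg != 0.
Proof. by apply/eqP => s0; move: sg2; rewrite s0 mul0r => /eqP; rewrite eq_sym oner_eq0. Qed.

Lemma torus_coord_neq0 j t : torus_coord j t != 0.
Proof. by rewrite mulf_neq0 ?sg_neq0 ?expi_neq0. Qed.

Lemma torus_coordM j k t : torus_coord j t * torus_coord k t = expi (2 * t 0 j) * expi (2 * t 0 k).
Proof. by rewrite /torus_coord mulrACA sg2 mul1r. Qed.

Lemma torus_coord_sqr j t : reg t -> torus_coord j t ^+ 2 != 1.
Proof. by move/(regular_double j); rewrite [torus_coord _ _ ^+ 2]expr2 torus_coordM -expr2. Qed.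

Lemma torus_coord_neq1 j t : reg t -> torus_coord j t != 1.
Proof. by move/(torus_coord_sqr j); apply: contraNneq => ->; rewrite expr1n. Qed.

Lemma torus_coord_neqN1 j t : reg t -> 1 + torus_coord j t != 0.
Proof.
move/(torus_coord_sqr j); apply: contraNneq => /eqP; rewrite addrC addr_eq0 => /eqP ->.
by rewrite sqrrN expr1n.
Qed.

Lemma torus_coordV j t : (torus_coord j t)^-1 = sg * (expi (2 * t 0 j))^-1.
Proof.
by apply: (mulfI (torus_coord_neq0 j t)); rewrite divff ?torus_coord_neq0// mulrACA sg2 mul1r divff ?expi_neq0.
Qed.

Lemma torus_coord_div j k t : torus_coord k t * (torus_coord j t)^-1 = expi (- 2 * (t 0 j - t 0 k)).
Proof.
rewrite torus_coordV mulrACA sg2 mul1r -expiN -expiD; congr expi; ring.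
Qed.

Lemma torus_coord_prodV j k t : (torus_coord j t * torus_coord k t)^-1 = expi (- 2 * (t 0 j + t 0 k)).
Proof. by rewrite torus_coordM -expiD -expiN; congr expi; ring. Qed.

Lemma torus_coord_neq j k t : reg t -> a != 0 -> j != k -> torus_coord j t != torus_coord k t.
Proof.
move=> rt a0 jk; apply: contraNneq (regular_diff rt a0 jk) => E.
have := torus_coord_div j k t; rewrite E divff ?torus_coord_neq0// mulNr expiN => /eqP.
by rewrite eq_sym invr_eq1.
Qed.

Lemma torus_coord_prod_neq1 j k t : reg t -> a != 0 -> j != k -> torus_coord j t * torus_coord k t != 1.
Proof. by move=> rt a0 jk; rewrite torus_coordM -expiD -mulrDr (regular_sum rt a0 jk). Qed.

Definition monomial (h : 'I_r -> R[i] -> R[i]) t : R[i] := \prod_l h l (torus_coord l t).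

Lemma monomial2 h j k t : j != k ->
  monomial h t = h j (torus_coord j t) * h k (torus_coord k t)
                 * \prod_(l | (l != j) && (l != k)) h l (torus_coord l t).
Proof. by move=> jk; rewrite /monomial (bigD1 j) //= (bigD1 k) 1?eq_sym //= mulrA. Qed.

Lemma monomial_exchange h j k t : j != k ->
  monomial h (exchange j k t) = h j (torus_coord k t) * h k (torus_coord j t)
                 * \prod_(l | (l != j) && (l != k)) h l (torus_coord l t).
Proof.
move=> jk; rewrite (monomial2 _ _ jk) /torus_coord !coordE eqxx eq_sym (negPf jk) eqxx.
congr (_ * _); apply: eq_bigr => l /andP[lj lk].
by rewrite !coordE (negPf lj) (negPf lk).
Qed.

Lemma monomial_signed_exchange h j k t : j != k ->
  monomial h (signed_exchange j k t) = h j (torus_coord k t)^-1 * h k (torus_coord j t)^-1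
                 * \prod_(l | (l != j) && (l != k)) h l (torus_coord l t).
Proof.
move=> jk; rewrite (monomial2 _ _ jk) !torus_coordV /torus_coord !coordE eqxx eq_sym (negPf jk) eqxx.
rewrite !mulrN !expiN.
congr (_ * _); apply: eq_bigr => l /andP[lj lk].
by rewrite !coordE (negPf lj) (negPf lk).
Qed.

Lemma monomial1 h j t :
  monomial h t = h j (torus_coord j t) * \prod_(l | l != j) h l (torus_coord l t).
Proof. by rewrite /monomial (bigD1 j). Qed.

Lemma monomial_sign_change h j t :
  monomial h (sign_change j t) =
  h j (torus_coord j t)^-1 * \prod_(l | l != j) h l (torus_coord l t).
Proof.
rewrite (monomial1 _ j) !torus_coordV /torus_coord !coordE eqxx mulrN expiN.
congr (_ * _); apply: eq_bigr => l lj.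
by rewrite !coordE (negPf lj).
Qed.

Lemma minus_op_monomial h j k t : j != k -> A j k (monomial h) t =
  kappa a * ((1 - torus_coord k t * (torus_coord j t)^-1)^-1 - (k < j)%N%:R)
  * (h j (torus_coord j t) * h k (torus_coord k t) - h j (torus_coord k t) * h k (torus_coord j t))
  * \prod_(l | (l != j) && (l != k)) h l (torus_coord l t).
Proof.
move=> jk; rewrite /minus_op /difference (monomial_exchange _ _ jk) (monomial2 _ _ jk).
by rewrite -mulrBl mulrA torus_coord_div.
Qed.

Lemma plus_op_monomial h j k t : j != k -> B j k (monomial h) t =
  kappa a * (1 - (torus_coord j t * torus_coord k t)^-1)^-1
  * (h j (torus_coord j t) * h k (torus_coord k t) - h j (torus_coord k t)^-1 * h k (torus_coord j t)^-1)
  * \prod_(l | (l != j) && (l != k)) h l (torus_coord l t).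
Proof.
move=> jk; rewrite /plus_op /difference (monomial_signed_exchange _ _ jk) (monomial2 _ _ jk).
by rewrite -mulrBl mulrA torus_coord_prodV.
Qed.

Lemma has_partial_torus_coord j t : has_partial j (torus_coord j) t (2 * 'i%C * torus_coord j t).
Proof.
have E : torus_coord j = fun u => sg * expi (dotv u (2 *: eps R j)).
  by apply/funext => u; rewrite /torus_coord dotvZr dotv_eps.
rewrite [X in has_partial _ X]E; apply: has_partial_eq.
  by apply: has_partialM; [exact: has_partial_cst|exact: has_partial_expi].
rewrite mulr0 addr0 !mxE !eqxx /= mulr1 /torus_coord dotvZr dotv_eps (_ : (2%:C : R[i]) = 2).
  by move: (expi _) => y; ring.
by rewrite rmorph_nat.
Qed.

Lemma has_partial_cayley j t : reg t -> has_partial j (fun u => cayley (torus_coord j u)) t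
  (2 * 'i%C * (1 - cayley (torus_coord j t)) * cayley (torus_coord j t)).
Proof.
move=> rt; have x1 := torus_coord_neqN1 j rt; have dx := has_partial_torus_coord j t.
have d1 : has_partial j (fun u => 1 + torus_coord j u) t (0 + 2 * 'i%C * torus_coord j t).
  by apply: has_partialD => //; exact: has_partial_cst.
apply: has_partial_eq; first exact: has_partialM dx (has_partialV x1 d1).
rewrite -cocayleyE // /cayley /cocayley add0r.
move: (torus_coord j t) x1 (2 * 'i%C) => x x1 c.
move: ((1 + x)^-1) (mulVf x1) => y y1.
have -> : y * (c * x) = y * (1 + x) * y * (c * x) by rewrite y1 mul1r.
by ring.
Qed.

Lemma has_partial_monomial h j t (d : R[i]) :
  has_partial j (fun u => h j (torus_coord j u)) t (d * h j (torus_coord j t)) ->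
  has_partial j (monomial h) t (d * monomial h t).
Proof.
move=> dh; have E : monomial h = fun u => h j (torus_coord j u) * \prod_(l | l != j) h l (torus_coord l u).
  by apply/funext => u; rewrite (monomial1 _ j).
rewrite [X in has_partial _ X]E (monomial1 _ j); apply: has_partial_eq.
  apply: has_partialM; first exact: dh.
  apply: has_partial_indep => x; apply: eq_bigr => l lj.
  by rewrite /torus_coord !mxE (negPf lj) andbF mulr0 addr0.
by rewrite mulr0 add0r mulrC mulrA.
Qed.

(** If every part of D_j multiplies the monomial, so does D_j after multiplication
    by the invariant function f, and the multipliers add up. *)
Lemma cherednik_monomial h j t (d e : R[i]) (c : 'I_r -> R[i]) : reg t ->
  has_partial j (monomial h) t (d * monomial h t) ->
  (forall k, k != j -> A j k (monomial h) t + B j k (monomial h) t = kappa a * c k * monomial h t) ->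
  Q j (monomial h) t = e * monomial h t ->
  D j (fun u => f u * monomial h u) t =
  ('i%C * delta%:C * (2 * cayley (torus_coord j t) - 1) + d + kappa a * (\sum_(k | k != j) c k) + e
   - 'i%C * (rho r a b iota j.+1)%:C) * (f t * monomial h t).
Proof.
move=> rt dm cAB eQ; rewrite cherednikE //.
have dif cc w pi ee : reflection w pi ee ->
    difference cc w (fun u => f u * monomial h u) t = f t * difference cc w (monomial h) t.
  by move=> wr; rewrite /difference (f_inv wr) -mulrBr mulrCA.
rewrite (has_partialE (has_partialM (f_partial j rt) dm)) /reflection_op /pair_op.
rewrite (eq_bigr (fun k => f t * (kappa a * c k * monomial h t))) => [|k kj]; last first.
  rewrite /minus_op /plus_op (dif _ _ _ _ (exchange_reflection R j k)).
  by rewrite (dif _ _ _ _ (signed_exchange_reflection R j k)) -mulrDr -cAB.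
rewrite /axis_op (dif _ _ _ _ (sign_change_reflection R j)) -/(axis_op b iota j _ t) eQ.
rewrite -mulr_sumr -mulr_suml -mulr_sumr.
move: (\sum_(i | _) _) (kappa a) ('i%C * _) (cayley _) ('i%C * _) (f t) (monomial h t) => *.
ring.
Qed.

Lemma sum_lt (m : 'I_r) (c : R[i]) : \sum_(k < r | (k < m)%N) c = m%:R * c.
Proof.
by rewrite (big_ord_narrow (ltnW (ltn_ord m))) sumr_const card_ord mulr_natl.
Qed.

Lemma sum_gt (m : 'I_r) (c : R[i]) : \sum_(k < r | (m < k)%N) c = (r%:R - m.+1%:R) * c.
Proof.
have : \sum_(k < r) c = r%:R * c by rewrite sumr_const card_ord mulr_natl.
rewrite (bigD1 m) //= (sum_split_lt (fun=> c)) sum_lt => E.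
rewrite mulrBl -E -natr1 mulrDl mul1r.
by move: (\sum_(_ < r | _) _) => S; ring.
Qed.

Definition rho_shift : R[i] := (delta + rho r a b iota 1)%:C.

Definition raise_factor (n : nat) (l : 'I_r) : R[i] -> R[i] :=
  if (l < n)%N then @cayley _ else fun=> 1.

Definition lower_factor (n : nat) (l : 'I_r) : R[i] -> R[i] :=
  if (l < n)%N then @cayley _ else fun x => cayley x * cocayley x.

Lemma ltnS_neq (l m : 'I_r) : l != m -> (l < m.+1)%N = (l < m)%N.
Proof. by move=> lm; rewrite ltnS [RHS]ltn_neqAle lm. Qed.

Lemma monomial_raise (m : 'I_r) t :
  monomial (raise_factor m.+1) t = cayley (torus_coord m t) * monomial (raise_factor m) t.
Proof.
rewrite !(monomial1 _ m) /raise_factor ltnSn ltnn mul1r; congr (_ * _).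
by apply: eq_bigr => l lm; rewrite ltnS_neq.
Qed.

Lemma monomial_lower (m : 'I_r) t :
  monomial (lower_factor m) t = cocayley (torus_coord m t) * monomial (lower_factor m.+1) t.
Proof.
rewrite !(monomial1 _ m) /lower_factor ltnSn ltnn -mulrA mulrCA; congr (_ * (_ * _)).
by apply: eq_bigr => l lm; rewrite ltnS_neq.
Qed.

(** With m counted from 1 this is c - rho_m = delta + a (m - 1), which makes the
    multiplier of [cherednik_raise] vanish at v_m = 0. *)
Lemma rho_shiftB (m : 'I_r) : rho_shift - (rho r a b iota m.+1)%:C = delta%:C + a%:C * m%:R.
Proof.
rewrite /rho_shift -rmorphB -(rmorph_nat (real_complex R)) -rmorphM -rmorphD; congr (_%:C).
by rewrite /rho -natr1; ring.
Qed.

Lemma rho_shiftD (m : 'I_r) : rho_shift + (rho r a b iota m.+1)%:C =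
  delta%:C + p%:C + q%:C + a%:C * m%:R + 2 * a%:C * (r%:R - m.+1%:R).
Proof.
have E : delta + rho r a b iota 1 + rho r a b iota m.+1 =
    delta + p + q + a * m%:R + 2 * a * (r%:R - m.+1%:R).
  have -> : p = 2 * (iota + b) - q by rewrite -pq addrK.
  by rewrite /rho -natr1; ring.
by rewrite /rho_shift -rmorphD E !(rmorph_nat, rmorphB, rmorphM, rmorphD).
Qed.

Lemma pair_term (K : fieldType) (kap c1 u1 c2 u2 rest g h : K) :
  c1 * u1 + c2 * u2 = g * h ->
  kap * c1 * u1 * rest + kap * c2 * u2 * rest = kap * g * (h * rest).
Proof.
move=> E; transitivity (kap * (c1 * u1 + c2 * u2) * rest); first by ring.
by rewrite E; ring.
Qed.

Lemma single_term (K : fieldType) (kap c u rest g h : K) :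
  c * u = g * h -> kap * c * (u * rest) = kap * g * (h * rest).
Proof. by move=> E; rewrite -!mulrA (mulrA c) E !mulrA. Qed.

(** Only the indices k < m contribute: the monomial does not involve the
    coordinate m nor those after it. *)
Lemma cherednik_raise (m : 'I_r) t : reg t ->
  D m (fun u => f u * monomial (raise_factor m) u) t
  + 'i%C * rho_shift * (f t * monomial (raise_factor m) t) =
  2 * 'i%C * (delta%:C + a%:C * m%:R) * (f t * monomial (raise_factor m.+1) t).
Proof.
move=> rt; set h := raise_factor m; pose x := torus_coord m t.
pose c (k : 'I_r) : R[i] := if (k < m)%N then 2 * cayley x - 1 else 0.
have x1 l := torus_coord_neqN1 l rt; have x0 l := torus_coord_neq0 l t.
have hm : h m = fun=> 1 by rewrite /h /raise_factor ltnn.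
have d0 : has_partial m (monomial h) t (0 * monomial h t).
  apply: has_partial_monomial; rewrite mul0r; apply: has_partial_indep => y.
  by rewrite hm.
rewrite (cherednik_monomial (d := 0) (e := 0) (c := c) rt d0); first last.
- rewrite mul0r /axis_op /difference monomial_sign_change (monomial1 _ m) hm subrr mulr0 //.
- move=> k km; have mk : m != k by rewrite eq_sym.
  rewrite (minus_op_monomial _ _ mk) (plus_op_monomial _ _ mk) (monomial2 _ _ mk) hm /c.
  have [a0|a0] := eqVneq a 0; first by rewrite /kappa a0 mulr0 !mul0r addr0.
  have xy := torus_coord_neq rt a0 mk; have xy1 := torus_coord_prod_neq1 rt a0 mk.
  apply: pair_term; rewrite !mul1r /h /raise_factor; case: ltnP => km'; last first.
    by rewrite subrr !mulr0 addr0 mul0r.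
  exact: raise_lt.
have -> : \sum_(k < r | k != m) c k = m%:R * (2 * cayley x - 1).
  rewrite sum_split_lt (eq_bigr (fun=> 2 * cayley x - 1)) => [|k km]; last by rewrite /c km.
  by rewrite sum_lt [X in _ + X]big1 ?addr0 => [//|k km]; rewrite /c ltnNge (ltnW km).
rewrite monomial_raise -/h -/x.
have := rho_shiftB m; rewrite /kappa; move: (rho_shift) ((rho _ _ _ _ _)%:C) => T rh /eqP.
rewrite subr_eq => /eqP ->.
move: (delta%:C) (a%:C) (cayley x) (f t) (monomial h t) => *.
ring.
Qed.

(** For k < m the monomial is symmetric in the coordinates k and m, and only the
    root e_m + e_k contributes; for k > m both e_m - e_k and e_m + e_k do. *)
Lemma cherednik_lower (m : 'I_r) t : reg t ->
  D m (fun u => f u * monomial (lower_factor m.+1) u) t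
  - 'i%C * rho_shift * (f t * monomial (lower_factor m.+1) t) =
  - 2 * 'i%C * (delta%:C + q%:C - 1 + a%:C * (r%:R - m.+1%:R)) * (f t * monomial (lower_factor m) t).
Proof.
move=> rt; set h := lower_factor m.+1; pose x := torus_coord m t.
pose c (k : 'I_r) : R[i] := if (k < m)%N then 1 else 2 * cayley x.
have x1 l := torus_coord_neqN1 l rt; have x0 l := torus_coord_neq0 l t.
have hm : h m = @cayley _ by rewrite /h /lower_factor ltnSn.
have d0 : has_partial m (monomial h) t (2 * 'i%C * (1 - cayley x) * monomial h t).
  by apply: has_partial_monomial; rewrite hm; exact: has_partial_cayley.
rewrite (cherednik_monomial (e := 'i%C * (p%:C + q%:C * (2 * cayley x - 1))) (c := c) rt d0); first last.
- rewrite /axis_op /difference monomial_sign_change (monomial1 _ m) hm coef_axisE // -/x.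
  have L := lower_single p%:C q%:C (x0 m) (x1 m) (torus_coord_neq1 m rt).
  rewrite -mulrBl; exact: single_term L.
- move=> k km; have mk : m != k by rewrite eq_sym.
  rewrite (minus_op_monomial _ _ mk) (plus_op_monomial _ _ mk) (monomial2 _ _ mk) hm /c.
  have [a0|a0] := eqVneq a 0; first by rewrite /kappa a0 mulr0 !mul0r addr0.
  have xy := torus_coord_neq rt a0 mk; have xy1 := torus_coord_prod_neq1 rt a0 mk.
  apply: pair_term; rewrite /h /lower_factor ltnS_neq //; case: ltnP => km'.
    rewrite [cayley (torus_coord k t) * _]mulrC subrr mulr0 add0r mul1r.
    exact: lower_lt.
  rewrite subr0; exact: lower_gt.
have -> : \sum_(k < r | k != m) c k = m%:R + (r%:R - m.+1%:R) * (2 * cayley x).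
  rewrite sum_split_lt (eq_bigr (fun=> 1)) => [|k km]; last by rewrite /c km.
  rewrite [X in _ + X](eq_bigr (fun=> 2 * cayley x)) => [|k km].
    by rewrite sum_lt sum_gt mulr1.
  by rewrite /c ltnNge (ltnW km).
rewrite monomial_lower -/h cocayleyE // -/x.
have := rho_shiftD m; rewrite /kappa; move: (rho_shift) ((rho _ _ _ _ _)%:C) => T rh /eqP.
rewrite eq_sym -subr_eq => /eqP <-.
move: (delta%:C) (a%:C) (cayley x) (f t) (monomial h t) (r%:R : R[i]) (m.+1%:R : R[i]) => *.
ring.
Qed.

Local Notation scst := (@smooth_cst R r a).

Lemma cherednik_linear j (c : R[i]) F G t : smooth F -> smooth G -> reg t ->
  D j (fun u => F u + c * G u) t = D j F t + c * D j G t.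
Proof.
move=> sF sG rt; have sc := smoothM (scst c) sG.
rewrite !cherednikE // (partialD j sF sc rt) (partialM j (scst c) sG rt) partial_cst.
rewrite mulr0 addr0 reflection_opD reflection_opZ.
move: (partial j F t) (partial j G t) (reflection_op _ _ _ _ F t) (reflection_op _ _ _ _ G t) (F t) (G t) => *.
ring.
Qed.

Lemma cherednikZ j (c : R[i]) F t : smooth F -> reg t ->
  D j (fun u => c * F u) t = c * D j F t.
Proof.
move=> sF rt; rewrite !cherednikE // (partialM j (scst c) sF rt) partial_cst.
rewrite mulr0 addr0 reflection_opZ; move: (partial j F t) (reflection_op _ _ _ _ F t) (F t) => *.
ring.
Qed.

Definition raise_op j F : V -> R[i] := fun t => D j F t + 'i%C * rho_shift * F t.
Definition lower_op j F : V -> R[i] := fun t => D j F t + (- ('i%C * rho_shift)) * F t.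
Definition factor_op j F : V -> R[i] := fun t => D j (D j F) t + rho_shift ^+ 2 * F t.

Lemma smooth_shift_op j (c : R[i]) F : smooth F -> smooth (fun t => D j F t + c * F t).
Proof.
by move=> sF; exact: smoothD (smooth_cherednik b iota j sF) (smoothM (scst c) sF).
Qed.

Lemma smooth_factor_op j F : smooth F -> smooth (factor_op j F).
Proof.
move=> sF; have sD := smooth_cherednik b iota j sF.
exact: smoothD (smooth_cherednik b iota j sD) (smoothM (scst _) sF).
Qed.

Lemma factor_op_ext j F G t : (forall u, reg u -> F u = G u) -> reg t ->
  factor_op j F t = factor_op j G t.
Proof.
move=> FG rt; rewrite /factor_op (FG t rt); congr (_ + _).
by apply: cherednik_ext rt => u ru; exact: cherednik_ext.
Qed.

Lemma factor_opE j F t : smooth F -> reg t ->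
  factor_op j F t = lower_op j (raise_op j F) t.
Proof.
move=> sF rt; have sD := smooth_cherednik b iota j sF.
rewrite /factor_op /lower_op /raise_op cherednik_linear //.
have i2 : 'i%C * 'i%C = -1 :> R[i] by rewrite -expr2 sqr_i.
move: (D j (D j F) t) (D j F t) (F t) (rho_shift) => x y z T.
transitivity (x + ('i%C * T - 'i%C * T) * y - ('i%C * 'i%C) * T ^+ 2 * z); last by ring.
by rewrite i2; ring.
Qed.

Lemma raise_factor_opC j k F t : smooth F -> reg t ->
  raise_op j (factor_op k F) t = factor_op k (raise_op j F) t.
Proof.
move=> sF rt; have sj := smooth_cherednik b iota j sF; have sk := smooth_cherednik b iota k sF.
have skk := smooth_cherednik b iota k sk; have skj := smooth_cherednik b iota k sj.
rewrite /raise_op /factor_op cherednik_linear //.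
rewrite [X in _ = X + _](_ : _ = D k (fun u => D k (D j F) u + 'i%C * rho_shift * D k F u) t); last first.
  by apply: cherednik_ext rt => u ru; rewrite cherednik_linear.
rewrite cherednik_linear // (_ : D k (D k (D j F)) t = D j (D k (D k F)) t).
  by move: (D j (D k (D k F)) t) (D k (D k F) t) (D j F t) (F t) => *; ring.
rewrite (cherednikC b iota j k sk rt); apply: cherednik_ext rt => u ru.
exact: cherednikC.
Qed.

Lemma smooth_factor_ops s F : smooth F -> smooth (foldr factor_op F s).
Proof. by move=> sF; elim: s => //= j s IH; exact: smooth_factor_op. Qed.

Lemma raise_op_ext j F G t : (forall u, reg u -> F u = G u) -> reg t ->
  raise_op j F t = raise_op j G t.
Proof. by move=> FG rt; rewrite /raise_op (FG t rt) (cherednik_ext _ _ j FG rt). Qed.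

Lemma lower_op_ext j F G t : (forall u, reg u -> F u = G u) -> reg t ->
  lower_op j F t = lower_op j G t.
Proof. by move=> FG rt; rewrite /lower_op (FG t rt) (cherednik_ext _ _ j FG rt). Qed.

Lemma raise_factor_ops s j F t : smooth F -> reg t ->
  raise_op j (foldr factor_op F s) t = foldr factor_op (raise_op j F) s t.
Proof.
move=> sF; elim: s t => //= k s IH t rt.
rewrite raise_factor_opC //; last exact: smooth_factor_ops.
exact: factor_op_ext IH rt.
Qed.

(** By commutativity the operators D_j + ic all move inwards, past the factors of
    the other indices; the innermost one is then that of the first index. *)
Lemma factor_ops_reorder s F t : smooth F -> reg t ->
  foldr factor_op F s t = foldr lower_op (foldr raise_op F (rev s)) s t.
Proof.
elim: s F t => //= j s IH F t sF rt.
rewrite factor_opE //; last exact: smooth_factor_ops.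
apply: lower_op_ext rt => u ru.
rewrite raise_factor_ops // IH //; last exact: smooth_shift_op.
by rewrite rev_cons -cats1 foldr_cat.
Qed.

Hypothesis sf : smooth f.

Lemma smooth_torus_coord j : smooth (torus_coord j).
Proof.
apply: smooth_ext (smoothM (scst sg) (smooth_expi a (2 *: eps R j))) _ => t _.
by rewrite /torus_coord dotvZr dotv_eps.
Qed.

Lemma smooth_cayley j : smooth (fun t => cayley (torus_coord j t)).
Proof.
apply: smoothM (smooth_torus_coord j) (smoothV (smoothD (scst 1) (smooth_torus_coord j)) _) => t rt.
exact: torus_coord_neqN1.
Qed.

Lemma smooth_cocayley j : smooth (fun t => cocayley (torus_coord j t)).
Proof.
apply: smoothV (smoothD (scst 1) (smooth_torus_coord j)) _ => t rt.
exact: torus_coord_neqN1.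
Qed.

Lemma smooth_monomial h : (forall l, smooth (fun t => h l (torus_coord l t))) -> smooth (monomial h).
Proof.
move=> sh; rewrite /monomial; elim: (index_enum _) => [|l s IH].
  by apply: smooth_ext (scst 1) _ => t _; rewrite big_nil.
by apply: smooth_ext (smoothM (sh l) IH) _ => t _; rewrite big_cons.
Qed.

Lemma smooth_raise n : smooth (fun t => f t * monomial (raise_factor n) t).
Proof.
apply: smoothM sf (smooth_monomial _) => l; rewrite /raise_factor.
by case: ifP => _; [exact: smooth_cayley|exact: scst].
Qed.

Lemma smooth_lower n : smooth (fun t => f t * monomial (lower_factor n) t).
Proof.
apply: smoothM sf (smooth_monomial _) => l; rewrite /lower_factor.
by case: ifP => _; [exact: smooth_cayley|apply: smoothM; [exact: smooth_cayley|exact: smooth_cocayley]].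
Qed.

Definition raise_const (l : 'I_r) : R[i] := 2 * 'i%C * (delta%:C + a%:C * l%:R).
Definition lower_const (l : 'I_r) : R[i] :=
  - 2 * 'i%C * (delta%:C + q%:C - 1 + a%:C * (r%:R - l.+1%:R)).

Local Notation E := (index_enum 'I_r).

Lemma size_E : size E = r.
Proof. by rewrite /index_enum -enumT size_enum_ord. Qed.

Lemma nth_E (m : 'I_r) : nth m E m = m.
Proof. by rewrite /index_enum -enumT nth_ord_enum. Qed.

Lemma raise_stage n t : (n <= r)%N -> reg t ->
  foldr raise_op f (rev (take n E)) t =
  \prod_(l <- take n E) raise_const l * (f t * monomial (raise_factor n) t).
Proof.
elim: n t => [|n IH] t.
  by move=> _ _; rewrite take0 big_nil mul1r /= /monomial big1 ?mulr1 // => l _.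
move=> nr rt; pose m := Ordinal nr.
have -> : take n.+1 E = rcons (take n E) m.
  by rewrite (take_nth m) ?size_E // -[X in nth _ _ X]/(val m) nth_E.
rewrite rev_rcons -cats1 big_cat big_seq1 /=.
rewrite (raise_op_ext m (fun u ru => IH u (ltnW nr) ru) rt) /raise_op.
rewrite (cherednikZ m _ (smooth_raise n) rt) mulrCA -mulrDr (cherednik_raise m rt).
by rewrite mulrA.
Qed.

Lemma monomial_raise_lower t : monomial (raise_factor r) t = monomial (lower_factor r) t.
Proof. by apply: eq_bigr => l _; rewrite /raise_factor /lower_factor ltn_ord. Qed.

(** The indices are consumed from the last one down, hence the induction on the
    number n of operators applied. *)
Lemma lower_stage n (c : R[i]) F t : (n <= r)%N ->
  (forall u, reg u -> F u = c * (f u * monomial (lower_factor r) u)) -> reg t ->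
  foldr lower_op F (drop (r - n) E) t =
  \prod_(l <- drop (r - n) E) lower_const l * (c * (f t * monomial (lower_factor (r - n)) t)).
Proof.
move=> + FE; elim: n t => [|n IH] t.
  by move=> _ rt; rewrite subn0 drop_oversize ?size_E // big_nil mul1r /= FE.
move=> nr rt.
have mr : (r - n.+1 < r)%N by rewrite ltn_subrL /= (leq_ltn_trans _ nr).
pose m := Ordinal mr.
have mE : (r - n = m.+1)%N by rewrite /= -subSn // subSS.
have -> : drop (r - n.+1) E = m :: drop (r - n) E.
  by rewrite mE (drop_nth m) ?size_E // -[X in nth _ _ X]/(val m) nth_E.
rewrite big_cons /= (lower_op_ext m (fun u ru => IH u (ltnW nr) ru) rt) /lower_op.
pose k := \prod_(l <- drop (r - n) E) lower_const l * c.
have kE u : \prod_(l <- drop (r - n) E) lower_const l *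
    (c * (f u * monomial (lower_factor (r - n)) u)) =
    k * (f u * monomial (lower_factor m.+1) u) by rewrite /k mE mulrA.
rewrite (cherednik_ext _ _ m (fun u _ => kE u) rt) kE.
rewrite (cherednikZ m _ (smooth_lower m.+1) rt) mulrCA -mulrDr mulNr (cherednik_lower m rt).
rewrite -/(lower_const m) /k mE /=.
by move: (lower_const m) (\prod_(l <- _) _) (f t * _) => *; ring.
Qed.

Lemma factor_ops_base t : reg t ->
  foldr factor_op f E t =
  (\prod_(l < r) ((delta + a * l%:R) * (delta + q - 1 + a * (r%:R - l.+1%:R))))%:C
  * (f t * \prod_(l < r) (4 * cayley (torus_coord l t) * cocayley (torus_coord l t))).
Proof.
move=> rt; rewrite (factor_ops_reorder _ sf rt).
have FE u : reg u -> foldr raise_op f (rev E) u =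
    \prod_(l < r) raise_const l * (f u * monomial (lower_factor r) u).
  move=> ru; have := raise_stage (leqnn r) ru.
  by rewrite take_oversize ?size_E // monomial_raise_lower.
have := lower_stage (leqnn r) FE rt; rewrite subnn drop0 => ->.
rewrite mulrA (mulrC (\prod_(l < r) lower_const l)) -big_split /=.
rewrite rmorph_prod mulrCA [RHS]mulrCA; congr (_ * _).
rewrite /monomial -!big_split /=; apply: eq_bigr => l _.
rewrite /raise_const /lower_const /lower_factor /=.
rewrite !(rmorph_nat, rmorph1, rmorphB, rmorphM, rmorphD) /=.
have i2 : 'i%C * 'i%C = -1 :> R[i] by rewrite -expr2 sqr_i.
move: (delta%:C) (a%:C) (q%:C) (l%:R : R[i]) (r%:R : R[i]) (l.+1%:R : R[i]) (cayley _) (cocayley _) => d aa qq x y z v w.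
transitivity ('i%C * 'i%C * (- 4) * ((d + aa * x) * (d + qq - 1 + aa * (y - z))) * (v * w)).
  by ring.
by rewrite i2; ring.
Qed.

End Shift.

(** * Powers of |Cos| and |Sin| *)

Section Powers.
Variables (R : realType) (r : nat) (a b iota delta : R).
Local Notation V := 'rV[R]_r.
Local Notation reg := (regular a).
Implicit Types (t u : V) (j k l : 'I_r).

Variables (G G' : R -> R) (sg : R[i]).
Hypothesis dG : forall x, is_derive (x : R) (1 : R) G (G' x).
Hypothesis G_even : forall x, `|G (- x)| = `|G x|.
Hypothesis G_neq0 : forall t j, reg t -> G (t 0 j) != 0.
Hypothesis G_log : forall t j, reg t ->
  (G' (t 0 j) / G (t 0 j))%:C = 'i%C * (2 * cayley (torus_coord sg j t) - 1).

Definition abs_pow t : R[i] := ((\prod_j `|G (t 0 j)|) `^ delta)%:C.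

Lemma abs_pow_reflection w p e t : reflection w p e -> abs_pow (w t) = abs_pow t.
Proof.
case=> wE pK _; rewrite /abs_pow; congr ((_ `^ _)%:C).
rewrite [RHS](reindex_inj (can_inj pK)); apply: eq_bigr => l _; rewrite wE.
by case: (e l); rewrite ?expr0 ?expr1 ?mul1r// mulN1r G_even.
Qed.

(** Writing |y|^delta as (y^2)^(delta/2) avoids the absolute value. *)
Lemma is_derive_abs_pow (x : R) : G x != 0 ->
  is_derive (0 : R) 1 (fun h => `|G (x + h)| `^ delta) (delta * (G' x / G x) * `|G x| `^ delta).
Proof.
move=> Gx; have E (y : R) : `|y| `^ delta = (y ^+ 2) `^ (delta / 2).
  by rewrite -real_normK ?num_real // -powR_mulrn // -powRrM mulrC divfK.
have G2 : 0 < G x ^+ 2 by rewrite exprn_even_gt0.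
have dx : is_derive (0 : R) 1 (fun h : R => x + h) 1.
  rewrite [X in is_derive _ _ X _](_ : _ = cst x + id); last by apply/funext.
  by apply: is_derive_eq; rewrite add0r.
have d1 : is_derive (0 : R) 1 (G \o (fun h : R => x + h)) (G' x).
  have dGx : is_derive (x + 0 : R) (1 : R) G (G' x) by rewrite addr0.
  by apply: is_derive_eq (is_derive1_comp dGx dx) _; rewrite mulr1.
have d2 : is_derive (0 : R) 1 ((G \o (fun h : R => x + h)) ^+ 2) (2 * G x * G' x).
  by apply: is_derive_eq; rewrite /= addr0 expr1.
rewrite [X in is_derive _ _ X _](_ : _ = (fun y => y `^ (delta / 2)) \o ((G \o (fun h : R => x + h)) ^+ 2)).
  have dp : is_derive (((G \o (fun h : R => x + h)) ^+ 2) 0) (1 : R)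
      (fun y => y `^ (delta / 2)) (delta / 2 * (G x ^+ 2) `^ (delta / 2 - 1)).
    by rewrite !fctE /= addr0; exact: is_derive1_powR.
  apply: is_derive_eq (is_derive1_comp dp d2) _.
  rewrite E powRB; last by rewrite (gt_eqF G2) implybT.
  rewrite powRr1 ?ltW // /GRing.scale /=; field.
  by rewrite Gx.
by apply/funext => h; rewrite !fctE /= E.
Qed.

Lemma has_partial_abs_pow j t : reg t -> has_partial j abs_pow t
  ('i%C * delta%:C * (2 * cayley (torus_coord sg j t) - 1) * abs_pow t).
Proof.
move=> rt; rewrite [X in X * abs_pow t](_ : _ = (delta * (G' (t 0 j) / G (t 0 j)))%:C); last first.
  by rewrite rmorphM /= G_log // mulrA [delta%:C * _]mulrC.
pose P := (\prod_(l | l != j) `|G (t 0 l)|) `^ delta.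
have E (h : R) : (\prod_l `|G ((t + h *: eps R j) 0 l)|) `^ delta = P * `|G (t 0 j + h)| `^ delta.
  rewrite (bigD1 j) //= powRM ?prodr_ge0 // mulrC !mxE !eqxx mulr1; congr (_ `^ _ * _).
  by apply: eq_bigr => l lj; rewrite !mxE (negPf lj) andbF mulr0 addr0.
have E0 : (\prod_l `|G (t 0 l)|) `^ delta = P * `|G (t 0 j)| `^ delta.
  by rewrite -[t 0 j]addr0 -E scale0r addr0.
rewrite /abs_pow -rmorphM; split.
- rewrite [X in is_derive _ _ X _](_ : _ = P \*: (fun h => `|G (t 0 j + h)| `^ delta)).
    apply: is_derive_eq; first by apply: is_deriveZ; apply: is_derive_abs_pow; exact: G_neq0.
    by rewrite /= E0 /GRing.scale /= mulrCA.
  by apply/funext => h; rewrite /abs_pow /= E.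
- rewrite [X in is_derive _ _ X _](_ : _ = cst 0); first exact: is_derive_cst.
  by apply/funext.
Qed.

Hypothesis sg2 : sg * sg = 1.

Lemma smooth_abs_pow : smooth a abs_pow.
Proof.
pose L j t : R[i] := 'i%C * delta%:C * (2 * cayley (torus_coord sg j t) + (-1)).
have sL j : smooth a (L j).
  have sc := @smooth_cst R r a; have sC := smooth_cayley a sg2 j.
  exact: smoothM (sc _) (smoothD (smoothM (sc 2) sC) (sc (-1))).
have indep j k t : j != k -> partial j (L k) t = 0.
  move=> jk; apply: has_partialE; apply: has_partial_indep => h.
  by rewrite /L /torus_coord !mxE [k == j]eq_sym (negPf jk) andbF mulr0 addr0.
apply: (@smooth_logder _ _ _ _ L) => // [j t rt|j k t rt].
  exact: has_partial_abs_pow.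
have [->//|jk] := eqVneq j k.
by rewrite !indep // eq_sym.
Qed.

Hypothesis G_sqr : forall t j, reg t ->
  4 * cayley (torus_coord sg j t) * cocayley (torus_coord sg j t) = ((G (t 0 j) ^+ 2)^-1)%:C.

Lemma abs_pow_shift t : reg t ->
  abs_pow t * \prod_j (4 * cayley (torus_coord sg j t) * cocayley (torus_coord sg j t)) =
  ((\prod_j `|G (t 0 j)|) `^ (delta - 2))%:C.
Proof.
move=> rt; rewrite (eq_bigr _ (fun j _ => G_sqr j rt)) -rmorph_prod -rmorphM; congr (_%:C).
have P0 : \prod_j `|G (t 0 j)| != 0.
  by apply/prodf_neq0 => j _; rewrite normr_eq0 G_neq0.
rewrite powRB ?P0 ?implybT // powR_mulrn ?prodr_ge0 //; congr (_ * _).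
rewrite prodfV -prodrXl; congr (_^-1); apply: eq_bigr => j _.
by rewrite real_normK ?num_real.
Qed.

Variables (p q : R).
Hypothesis pq : p + q = 2 * (iota + b).
Hypothesis coef_axisE : forall j t, reg t ->
  coef_axis b iota j t =
  'i%C * (p%:C * (1 - (torus_coord sg j t)^-1)^-1 + q%:C * (1 + (torus_coord sg j t)^-1)^-1).

Lemma factor_ops_abs_pow t : reg t ->
  foldr (factor_op a b iota delta) abs_pow (index_enum 'I_r) t =
  ((\prod_(1 <= j < r.+1)
        ((delta + a * (j%:R - 1)) * (delta + q - 1 + a * (r%:R - j%:R))))
     * (\prod_j `|G (t 0 j)|) `^ (delta - 2))%:C.
Proof.
move=> rt.
rewrite (factor_ops_base sg2 pq coef_axisE
  (fun w pi e wr u => abs_pow_reflection u wr) has_partial_abs_pow smooth_abs_pow rt).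
rewrite abs_pow_shift // -rmorphM big_add1 big_mkord; congr ((_ * _)%:C).
by apply: eq_bigr => l _; rewrite -natr1 addrK.
Qed.

End Powers.

Section Trigonometry.
Variable R : realType.
Implicit Types x : R.

Lemma cos4 x : cos (4 * x) = 1 - 8 * (sin x * cos x) ^+ 2.
Proof.
have -> : 4 * x = (x *+ 2) *+ 2 by rewrite -mulrnA mulr_natl.
by rewrite !cos_mulr2n exprMn sin2cos2 !mulr2n; ring.
Qed.

Lemma expi4_neq1 x : (expi (4 * x) != 1) = (sin x != 0) && (cos x != 0).
Proof.
rewrite expi_eq1 cos4 -negb_or -mulf_eq0; congr (~~ _).
rewrite -subr_eq0 addrAC subrr add0r oppr_eq0 [LHS]mulf_eq0 sqrf_eq0.
by rewrite pnatr_eq0.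
Qed.

Lemma sin_eq0_int x : sin x = 0 -> exists n : int, x = pi * n%:~R.
Proof.
move=> s0; pose n := Num.floor (x / pi); exists n.
have p0 := pi_gt0 R.
pose y := x - pi * n%:~R.
have y0 : 0 <= y by rewrite subr_ge0 mulrC -ler_pdivlMr // Num.Theory.floor_le_tmp.
have y1 : y < pi.
  rewrite ltrBlDr -{1}[pi]mulr1 -mulrDr mulrC -ltr_pdivrMr // addrC.
  by rewrite -(intrD _ _ 1) Num.Theory.floorD1_gt.
have sy : sin y = 0.
  apply/eqP; rewrite -normr_eq0 -(abs_sin_periodic n) subrK s0 normr0 //.
move: y0; rewrite le_eqVlt => /orP[/eqP y0|y0].
  by apply/eqP; rewrite -subr_eq0 -/y -y0.
by have := sin_gt0_pi (introT andP (conj y0 y1)); rewrite sy ltxx.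
Qed.

Lemma expi2_eq1 x : expi (2 * x) = 1 -> exists n : int, x = pi * n%:~R.
Proof.
move/eqP; rewrite expi_eq1 mulr_natl cos_mulr2n => /eqP c1; apply: sin_eq0_int.
by apply/eqP; rewrite -sqrf_eq0 sin2cos2 subr_eq0; apply/eqP; move: c1; rewrite mulr2n; lra.
Qed.

Lemma expi2E x : expi (2 * x) = expi x * expi x.
Proof. by rewrite -expiD -mulr2n mulr_natl. Qed.

Lemma expiE x : expi x = (cos x)%:C + 'i%C * (sin x)%:C.
Proof. by rewrite /expi [LHS]complexE. Qed.

Lemma expiNE x : (expi x)^-1 = (cos x)%:C - 'i%C * (sin x)%:C.
Proof. by rewrite -expiN expiE cosN sinN rmorphN mulrN. Qed.

End Trigonometry.

(** The values of v and w at u^2 and - u^2, for u = exp(it) = c + is. *)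
Section CayleyValues.
Variables (K : fieldType) (i u c s : K).
Hypotheses (i2 : i * i = -1) (u0 : u != 0) (two : 2 != 0 :> K).
Hypotheses (uE : u = c + i * s) (vE : u^-1 = c - i * s).

Let i0 : i != 0.
Proof.
by apply/eqP => i0; move: i2; rewrite i0 mul0r => /eqP; rewrite eq_sym oppr_eq0 oner_eq0.
Qed.

Lemma cayley_cos : c != 0 ->
  cayley (u * u) = u / (2 * c) /\ cocayley (u * u) = u^-1 / (2 * c).
Proof.
move=> c0; have E : 1 + u * u = u * (2 * c).
  rewrite -{1}(divff u0) -mulrDr; congr (_ * _); rewrite vE uE; ring.
rewrite /cayley /cocayley E; split; field; by rewrite ?c0 ?u0 ?two.
Qed.

Lemma cayley_sin : s != 0 ->
  cayley (- (u * u)) = u / (2 * i * s) /\ cocayley (- (u * u)) = - u^-1 / (2 * i * s).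
Proof.
move=> s0; have E : 1 - u * u = - u * (2 * i * s).
  rewrite -{1}(divff u0) -mulrBr mulNr -mulrN; congr (_ * _); rewrite vE uE; ring.
rewrite /cayley /cocayley E; split; field; by rewrite ?oppr_eq0 ?s0 ?u0 ?two ?i0.
Qed.

Lemma cayley_cos_log : c != 0 -> - s / c = i * (2 * cayley (u * u) - 1).
Proof.
move=> c0; rewrite (cayley_cos c0).1 uE.
transitivity (i * i * s / c); first by rewrite i2; ring.
by field; rewrite c0 two.
Qed.

Lemma cayley_sin_log : s != 0 -> c / s = i * (2 * cayley (- (u * u)) - 1).
Proof.
by move=> s0; rewrite (cayley_sin s0).1 uE; field; rewrite s0 two i0.
Qed.

Lemma cayley_cos_sqr : c != 0 ->
  4 * cayley (u * u) * cocayley (u * u) = (c ^+ 2)^-1.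
Proof.
move=> c0; have [-> ->] := cayley_cos c0.
by field; rewrite c0 u0 two.
Qed.

Lemma cayley_sin_sqr : s != 0 ->
  4 * cayley (- (u * u)) * cocayley (- (u * u)) = (s ^+ 2)^-1.
Proof.
move=> s0; have [-> ->] := cayley_sin s0.
transitivity (- (i * i)^-1 / s ^+ 2); last by rewrite i2 invrN1 opprK mul1r.
by field; rewrite s0 u0 two i0.
Qed.

End CayleyValues.

(** * The Bernstein-Sato formulas *)

Section Main.
Variables (R : realType) (r : nat) (a b iota delta : R).
Local Notation V := 'rV[R]_r.
Local Notation reg := (regular a).
Implicit Types (t u : V) (j k l : 'I_r).

Lemma regular_sin_cos t j : reg t -> sin (t 0 j) != 0 /\ cos (t 0 j) != 0.
Proof. by case=> /(_ j); rewrite expi4_neq1 => /andP. Qed.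

Lemma dotvC u t : dotv u t = dotv t u.
Proof. by apply: eq_bigr => j _; rewrite mulrC. Qed.

Lemma regularP t : off_hyperplanes a b iota t ->
  (forall j, sin (t 0 j) != 0) -> (forall j, cos (t 0 j) != 0) -> reg t.
Proof.
move=> off s0 c0; split => [j|a0 j k jk]; first by rewrite expi4_neq1 s0 c0.
have H (s : bool) : expi (2 * (t 0 j + (-1) ^+ s * t 0 k)) != 1.
  apply/eqP => /expi2_eq1[n E].
  have /eqP := off _ (@root_medium R r a b iota j k false s a0 jk) n; apply.
  by rewrite dotvC dotvDr !dotvZr !dotv_eps expr0 mul1r.
by split; [have := H true; rewrite expr1 mulN1r|have := H false; rewrite expr0 mul1r].
Qed.

(** The composition is taken on periodic functions, but each factor only sees the
    underlying function. *)
Lemma bernstein_sato_opE (F : torus_fun r a b iota) t :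
  bernstein_sato_op delta F t = foldr (factor_op a b iota delta) F (index_enum 'I_r) t.
Proof.
rewrite /bernstein_sato_op; elim: (index_enum _) t => [|j s IH] t.
  by rewrite big_nil.
rewrite big_cons [foldr _ _ (_ :: _)]/= [RHS]/factor_op /rho_shift -rmorphXn /=.
have -> : torus_val ((\big[(fun G H => G \o H)/id]_(l <- s) bernstein_sato_factor delta l) F) =
    foldr (factor_op a b iota delta) F s by apply/funext.
by [].
Qed.

Lemma two_neq0 : (2 : R[i]) != 0.
Proof. by rewrite pnatr_eq0. Qed.

Lemma split_cosec (K : fieldType) (z : K) : z != 0 -> z ^+ 2 != 1 ->
  2 * (1 - (z ^+ 2)^-1)^-1 = (1 - z^-1)^-1 + (1 + z^-1)^-1.
Proof.
move=> z0 z2; have [z1 z1'] : z - 1 != 0 /\ z + 1 != 0.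
  by apply/andP; rewrite -negb_or -mulf_eq0 -subr_sqr_1 subr_eq0.
by field; rewrite z0 z1 z1' subr_eq0 z2.
Qed.

Lemma coef_axis_split j t : reg t -> let z := expi (2 * t 0 j) in
  coef_axis b iota j t =
  'i%C * ((iota + 2 * b)%:C * (1 - z^-1)^-1 + iota%:C * (1 + z^-1)^-1).
Proof.
move=> rt z; have z2 := regular_double j rt; have z0 := expi_neq0 (2 * t 0 j).
rewrite /coef_axis /cfactor.
have -> : expi (- 2 * (2 * t 0 j)) = (z ^+ 2)^-1.
  by rewrite mulNr expiN expr2 -expiD; congr ((expi _)^-1); ring.
rewrite mulNr expiN -/z.
have := split_cosec z0 z2; rewrite -/z rmorphD rmorphM rmorph_nat /= => E.
move: (iota%:C) (b%:C) E => io bb.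
move: ((1 - z^-1)^-1) ((1 + z^-1)^-1) ((1 - (z ^+ 2)^-1)^-1) => x y w E.
transitivity ('i%C * io * (2 * w) + 2 * 'i%C * bb * x); first by ring.
by rewrite E; ring.
Qed.

Lemma factor_ops_cos t : reg t ->
  foldr (factor_op a b iota delta) (absCos_pow r a b iota delta) (index_enum 'I_r) t =
  ((\prod_(1 <= j < r.+1)
        ((delta + a * (j%:R - 1)) * (delta + iota - 1 + a * (r%:R - j%:R))))
     * absCos t `^ (delta - 2))%:C.
Proof.
have sgE j u : torus_coord (1 : R[i]) j u = expi (u 0 j) * expi (u 0 j).
  by rewrite /torus_coord mul1r expi2E.
have dcos (x : R) : is_derive (x : R) (1 : R) (@cos R) (- sin x) by exact: is_derive_cos.
have evn (x : R) : `|cos (- x)| = `|cos x| by rewrite cosN.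
have c0 u j : reg u -> cos (u 0 j) != 0 by case/(regular_sin_cos j).
have cC u j : reg u -> (cos (u 0 j))%:C != 0 :> R[i] by move/c0; rewrite fmorph_eq0; exact.
have i2 : 'i%C * 'i%C = -1 :> R[i] by rewrite -expr2 sqr_i.
apply: (@factor_ops_abs_pow R r a b iota delta _ _ 1 dcos evn c0 _ _ _ (iota + 2 * b) iota).
- move=> u j ru; rewrite sgE rmorphM fmorphV rmorphN.
  exact: cayley_cos_log i2 (expi_neq0 _) two_neq0 (expiE _) (expiNE _) (cC _ _ ru).
- by rewrite mulr1.
- move=> u j ru; rewrite sgE fmorphV rmorphXn.
  exact: cayley_cos_sqr (expi_neq0 _) two_neq0 (expiE _) (expiNE _) (cC _ _ ru).
- by ring.
- by move=> j u ru; rewrite /torus_coord mul1r coef_axis_split.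
Qed.

Lemma factor_ops_sin t : reg t ->
  foldr (factor_op a b iota delta) (absSin_pow r a b iota delta) (index_enum 'I_r) t =
  ((\prod_(1 <= j < r.+1)
        ((delta + a * (j%:R - 1)) * (delta + iota + 2 * b - 1 + a * (r%:R - j%:R))))
     * absSin t `^ (delta - 2))%:C.
Proof.
have sgE j u : torus_coord (-1 : R[i]) j u = - (expi (u 0 j) * expi (u 0 j)).
  by rewrite /torus_coord mulN1r expi2E.
have dsin (x : R) : is_derive (x : R) (1 : R) (@sin R) (cos x) by exact: is_derive_sin.
have evn (x : R) : `|sin (- x)| = `|sin x| by rewrite sinN normrN.
have c0 u j : reg u -> sin (u 0 j) != 0 by case/(regular_sin_cos j).
have cC u j : reg u -> (sin (u 0 j))%:C != 0 :> R[i] by move/c0; rewrite fmorph_eq0; exact.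
have i2 : 'i%C * 'i%C = -1 :> R[i] by rewrite -expr2 sqr_i.
under eq_bigr do rewrite -[delta + iota + _]addrA.
apply: (@factor_ops_abs_pow R r a b iota delta _ _ (-1) dsin evn c0 _ _ _ iota (iota + 2 * b)).
- move=> u j ru; rewrite sgE rmorphM fmorphV.
  exact: cayley_sin_log i2 (expi_neq0 _) two_neq0 (expiE _) (expiNE _) (cC _ _ ru).
- by rewrite mulrNN mulr1.
- move=> u j ru; rewrite sgE fmorphV rmorphXn.
  exact: cayley_sin_sqr i2 (expi_neq0 _) two_neq0 (expiE _) (expiNE _) (cC _ _ ru).
- by ring.
- move=> j u ru; rewrite /torus_coord mulN1r coef_axis_split // !invrN opprK.
  by congr (_ * _); exact: addrC.
Qed.

End Main.

Theorem theorem4p1 (R : realType) (r : nat) (a b iota delta : R)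
    (a_ge0 : 0 <= a) (b_ge0 : 0 <= 2 * b) (iota_ge0 : 0 <= iota)
    (delta_ge0 : 0 <= delta)
    (t : 'rV[R]_r)
    (t_off : off_hyperplanes a b iota t)
    (sin_neq0 : forall j : 'I_r, sin (t 0 j) != 0)
    (cos_neq0 : forall j : 'I_r, cos (t 0 j) != 0) :
  bernstein_sato_op delta (absCos_pow r a b iota delta) t =
    ((\prod_(1 <= j < r.+1)
        ((delta + a * (j%:R - 1)) * (delta + iota - 1 + a * (r%:R - j%:R))))
     * absCos t `^ (delta - 2))%:C
  /\
  bernstein_sato_op delta (absSin_pow r a b iota delta) t =
    ((\prod_(1 <= j < r.+1)
        ((delta + a * (j%:R - 1)) * (delta + iota + 2 * b - 1 + a * (r%:R - j%:R))))
     * absSin t `^ (delta - 2))%:C.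
Proof.
have rt := regularP t_off sin_neq0 cos_neq0.
by rewrite !bernstein_sato_opE factor_ops_cos // factor_ops_sin.
Qed.
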